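(* Suppose $\mathbb{E}_{P_0}K_{P_0}(X,X)<\infty$ and Stein's identity $\mathbb{E}_{P_0}\xi_{P_0}(X)=0$ holds. Then for every probability measure $P$ on $\mathcal{X}$ with $\mathbb{E}_P K_{P_0}(X,X)<\infty$ and every $n\ge 1$, if $X_1,\dots,X_n$ are i.i.d. from $P$, \[ \mathbb{E}_P\bigl|\widehat{\mathrm{KSD}}_V-\mathrm{KSD}(P_0,P)\bigr| \le\left(\frac{\mathbb{E}_P K_{P_0}(X,X)-\mathrm{KSD}^2(P_0,P)}{n}\right)^{1/2} \le\left(\frac{\mathbb{E}_P K_{P_0}(X,X)}{n}\right)^{1/2}. \] In particular, at the target ($P=P_0$), \[ \mathbb{E}_{P_0}\widehat{\mathrm{KSD}}_V\le\sqrt{\frac{\operatorname{tr}(C_\star)}{n}} . \]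
   Context: $P_0$ is a fixed probability distribution on $\mathcal{X}\subseteq\mathbb{R}^d$ with a continuously differentiable, everywhere positive density $p_0$; its score is $s_0(x)=\nabla\log p_0(x)$. $k\in C^{1,1}(\mathcal{X}\times\mathcal{X})$ is a positive definite kernel with reproducing kernel Hilbert space $\mathcal{H}_k$, and $\mathcal{H}:=\mathcal{H}_k^d$. The Langevin--Stein feature map is $\xi_{P_0}(x):=s_0(x)k(x,\cdot)+\nabla_x k(x,\cdot)\in\mathcal{H}$, and the Stein kernel is $K_{P_0}(x,y):=\langle\xi_{P_0}(x),\xi_{P_0}(y)\rangle_{\mathcal{H}}$. For a probability measure $P$ with $\mathbb{E}_PK_{P_0}(X,X)<\infty$, the Stein mean embedding is the Bochner integral $\mu_P:=\mathbb{E}_P\xi_{P_0}(X)$ and $\mathrm{KSD}(P_0,P):=\|\mu_P\|_{\mathcal{H}}$. Given a sample $X_1,\dots,X_n$, the plug-in (V-statistic) estimator is \[ \widehat{\mathrm{KSD}}_V:=\Bigl\|\frac1n\sum_{i=1}^n\xi_{P_0}(X_i)\Bigr\|_{\mathcal{H}}=\Bigl(\frac1{n^2}\sum_{i,j=1}^nK_{P_0}(X_i,X_j)\Bigr)^{1/2}. \] The Stein covariance operator is $C_\star:=\mathbb{E}_{P_0}[\xi_{P_0}(X)\otimes\xi_{P_0}(X)]$ on $\mathcal{H}$, where $a\otimes b$ is the operator $x\mapsto\langle b,x\rangle a$; it is positive, self-adjoint and trace class with $\operatorname{tr}(C_\star)=\mathbb{E}_{P_0}K_{P_0}(X,X)$.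 *)

(* Defs.v *)
From mathcomp Require Import all_boot all_order all_algebra.
From mathcomp Require Import all_classical all_reals all_analysis.
Import Order.TTheory GRing.Theory Num.Theory.
Import numFieldNormedType.Exports.

Set Implicit Arguments.
Unset Strict Implicit.
Unset Printing Implicit Defensive.

Local Open Scope classical_set_scope.
Local Open Scope ring_scope.

(* MathComp-Analysis has no inner-product spaces, so real Hilbert spaces,
   their finite powers, Bochner integrals and the trace are set up here. *)

Record hilbert (R : realType) := Hilbert {
  hsort :> lmodType R;
  dot : hsort -> hsort -> R;
  dotC : forall u v, dot u v = dot v u;
  dotPl : forall (a : R) u v w, dot (a *: u + v) w = a * dot u w + dot v w;
  dot_ge0 : forall u, 0 <= dot u u;
  dot_eq0 : forall u, dot u u = 0 -> u = 0;
  dot_complete : forall u : nat -> hsort,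
    (forall e : R, 0 < e -> exists N, forall m n, (N <= m)%N -> (N <= n)%N ->
       Num.sqrt (dot (u m - u n) (u m - u n)) < e) ->
    exists l, Num.sqrt (dot (u n - l) (u n - l)) @[n --> \oo] --> (0 : R) }.

Arguments dot {R h} : rename.

Definition hnorm (R : realType) (H : hilbert R) (u : H) : R :=
  Num.sqrt (dot u u).

Section hilbert_power.
Context (R : realType) (H : hilbert R) (d : nat).
Implicit Types u v w : {ffun 'I_d -> H}.

Definition pow_dot u v : R := \sum_(i < d) dot (u i) (v i).

Fact pow_dotC u v : pow_dot u v = pow_dot v u.
Proof. by apply: eq_bigr => i _; exact: dotC. Qed.

Fact pow_dotPl (a : R) u v w :
  pow_dot (a *: u + v) w = a * pow_dot u w + pow_dot v w.
Proof.
rewrite /pow_dot mulr_sumr -big_split/=; apply: eq_bigr => i _.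
by rewrite !ffunE dotPl.
Qed.

Fact pow_dot_ge0 u : 0 <= pow_dot u u.
Proof. by apply: sumr_ge0 => i _; exact: dot_ge0. Qed.

Fact pow_dot_eq0 u : pow_dot u u = 0 -> u = 0.
Proof.
move=> /eqP; rewrite psumr_eq0 => [/allP u0|i _]; last exact: dot_ge0.
apply/ffunP => i; rewrite ffunE; apply: dot_eq0; apply/eqP.
by apply: u0; rewrite mem_index_enum.
Qed.

Fact pow_dot_complete (u : nat -> {ffun 'I_d -> H}) :
  (forall e : R, 0 < e -> exists N, forall m n, (N <= m)%N -> (N <= n)%N ->
     Num.sqrt (pow_dot (u m - u n) (u m - u n)) < e) ->
  exists l, Num.sqrt (pow_dot (u n - l) (u n - l)) @[n --> \oo] --> (0 : R).
Proof.
move=> cu.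
have cui i : exists l, Num.sqrt (dot (u n i - l) (u n i - l)) @[n --> \oo] --> (0 : R).
  apply: dot_complete => e /cu[N uN]; exists N => m n Nm Nn.
  apply: le_lt_trans (uN m n Nm Nn); rewrite ler_wsqrtr// /pow_dot (bigD1 i)//=.
  by rewrite !ffunE lerDl sumr_ge0// => j _; exact: dot_ge0.
have [l ul] := choice cui; exists (finfun l).
rewrite -[X in _ --> X]sqrtr0; apply: (@continuous_cvg _ _ _ _ _ _ Num.sqrt).
  exact: sqrt_continuous.
rewrite [X in X @ _](_ : _ = fun n => \sum_(i < d)
    Num.sqrt (dot (u n i - l i) (u n i - l i)) ^+ 2); last first.
  apply/funext => n; apply: eq_bigr => i _.
  by rewrite !ffunE sqr_sqrtr// dot_ge0.
rewrite [X in _ --> X](_ : _ = \sum_(i < d) (0 ^+ 2 : R)); last first.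
  by rewrite big1// => i _; rewrite expr0n.
apply: cvg_big => [|i _]; [exact: add_continuous|]; rewrite expr2; under eq_fun do rewrite expr2.
by apply: cvgM; exact: ul.
Qed.

Definition hpow : hilbert R :=
  Hilbert pow_dotC pow_dotPl pow_dot_ge0 pow_dot_eq0 pow_dot_complete.

End hilbert_power.

Section bochner_integral.
Context (R : realType) (dT : measure_display) (T : measurableType dT).
Context (P : probability T R) (H : hilbert R).
Implicit Types f s : T -> H.

Definition simple s :=
  finite_set (range s) /\ forall v, measurable (s @^-1` [set v]).

Definition simple_integral (D : set T) s : H :=
  \sum_(v \in range s) fine (P (D `&` s @^-1` [set v])) *: v.

(* [f] is Bochner integrable on [D], with integral [v]. *)
Definition has_bochner_integral (D : set T) f (v : H) :=
  exists s : nat -> T -> H,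
    [/\ forall n, simple (s n),
        {ae P, forall x, D x -> hnorm (s n x - f x) @[n --> \oo] --> (0 : R)},
        (\int[P]_(x in D) (hnorm (f x - s n x))%:E @[n --> \oo] --> 0)%E &
        hnorm (simple_integral D (s n) - v) @[n --> \oo] --> (0 : R)].

Definition bochner (D : set T) f : H := xget 0 (has_bochner_integral D f).

End bochner_integral.

Section trace.
Context (R : realType) (H : hilbert R).

Definition tensor (a b : H) : H -> H := fun x => dot b x *: a.

Definition orthonormal_basis (B : set H) :=
  (forall a b, B a -> B b -> dot a b = (a == b)%:R) /\
  (forall f, (forall b, B b -> dot f b = 0) -> f = 0).

(* Trace of a positive trace-class operator; the value does not depend on the
   orthonormal basis that is chosen. *)
Definition trace (C : H -> H) : R :=
  fine (\esum_(b in xget set0 orthonormal_basis) (dot (C b) b)%:E).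

End trace.

Section euclidean.
Context (R : realType) (d : nat).

Definition rVborel := g_sigma_algebraType (@open 'rV[R]_d).

(* Lebesgue measure on R^d is the unique Borel measure with these values. *)
Definition is_lebesgue (lam : set rVborel -> \bar R) :=
  forall a b : 'rV[R]_d, (forall i, a 0 i <= b 0 i) ->
    lam [set x : 'rV[R]_d | forall i, a 0 i <= x 0 i <= b 0 i] =
      (\prod_(i < d) (b 0 i - a 0 i))%:E.

Definition basis_rV (i : 'I_d) : 'rV[R]_d := delta_mx 0 i.

Definition C1_on (U : set 'rV[R]_d) (f : 'rV[R]_d -> R) :=
  (forall x, U x -> differentiable f x) /\
  (forall i, {in U, continuous (fun x => 'D_(basis_rV i) f x)}).

Definition pderiv1 (i : 'I_d) (k : 'rV[R]_d -> 'rV[R]_d -> R) x y : R :=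
  'D_(basis_rV i) (fun x' => k x' y) x.

Definition pderiv2 (j : 'I_d) (k : 'rV[R]_d -> 'rV[R]_d -> R) x y : R :=
  'D_(basis_rV j) (fun y' => k x y') y.

(* Continuous partial derivatives of order at most one in each argument. *)
Definition C11_on (U : set 'rV[R]_d) (k : 'rV[R]_d -> 'rV[R]_d -> R) :=
  let jointly_continuous (g : 'rV[R]_d -> 'rV[R]_d -> R) :=
    {in U `*` U, continuous (fun z : 'rV[R]_d * 'rV[R]_d => g z.1 z.2)} in
  [/\ jointly_continuous k,
      (forall i x y, U x -> U y -> derivable (fun x' => k x' y) x (basis_rV i)) /\
        (forall i, jointly_continuous (pderiv1 i k)),
      (forall j x y, U x -> U y -> derivable (fun y' => k x y') y (basis_rV j)) /\
        (forall j, jointly_continuous (pderiv2 j k)) &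
      (forall i j x y, U x -> U y ->
          derivable (fun x' => pderiv2 j k x' y) x (basis_rV i)) /\
        (forall i j, jointly_continuous (pderiv1 i (pderiv2 j k)))].

Definition posdef_kernel (X : set 'rV[R]_d) (k : 'rV[R]_d -> 'rV[R]_d -> R) :=
  (forall x y, X x -> X y -> k x y = k y x) /\
  (forall (n : nat) (x : 'I_n -> 'rV[R]_d) (c : 'I_n -> R),
     (forall i, X (x i)) ->
     0 <= \sum_(i < n) \sum_(j < n) c i * c j * k (x i) (x j)).

(* A Hilbert space of functions on [X], realized by an injective linear
   evaluation map, whose reproducing kernel is [k].  Functions on [X] are
   total functions whose values outside [X] are ignored. *)
Record rkhs (X : set 'rV[R]_d) (k : 'rV[R]_d -> 'rV[R]_d -> R) := Rkhs {
  rk_hilbert :> hilbert R;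
  rk_eval : rk_hilbert -> 'rV[R]_d -> R;
  rk_evalP : forall (a : R) f g x, X x ->
    rk_eval (a *: f + g) x = a * rk_eval f x + rk_eval g x;
  rk_eval_inj : forall f g,
    (forall x, X x -> rk_eval f x = rk_eval g x) -> f = g;
  rk_reproducing : forall x, X x ->
    exists2 kx : rk_hilbert, (forall y, X y -> rk_eval kx y = k x y) &
      (forall f, rk_eval f x = dot f kx) }.

(* The element of the RKHS that, as a function on [X], is [g]. *)
Definition rk_elt X k (Hk : rkhs X k) (g : 'rV[R]_d -> R) : Hk :=
  xget 0 [set f | forall y, X y -> rk_eval f y = g y].

End euclidean.

Section stein.
Context (R : realType) (d : nat).
Context (X : set 'rV[R]_d) (k : 'rV[R]_d -> 'rV[R]_d -> R) (Hk : rkhs X k).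
Context (p0 : 'rV[R]_d -> R).

Definition score (x : 'rV[R]_d) (i : 'I_d) : R :=
  'D_(basis_rV R i) (fun z => ln (p0 z)) x.

Definition stein_feature (x : 'rV[R]_d) : hpow Hk d :=
  [ffun i => rk_elt Hk (fun y => score x i * k x y + pderiv1 i k x y)].

Definition stein_kernel (x y : 'rV[R]_d) : R :=
  dot (stein_feature x) (stein_feature y).

Definition mean_stein_diag (P : probability (rVborel R d) R) : \bar R :=
  (\int[P]_(x in (X : set (rVborel R d))) (stein_kernel x x)%:E)%E.

Definition stein_mean (P : probability (rVborel R d) R) : hpow Hk d :=
  bochner P (X : set (rVborel R d)) stein_feature.

Definition KSD (P : probability (rVborel R d) R) : R := hnorm (stein_mean P).

Definition KSD_V (n : nat) (x : 'I_n -> 'rV[R]_d) : R :=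
  hnorm (n%:R^-1 *: \sum_(i < n) stein_feature (x i)).

(* The integral of the operators [tensor (xi x) (xi x)], taken in the strong
   sense, that is, applied to each vector. *)
Definition stein_covariance (P0 : probability (rVborel R d) R)
    (f : hpow Hk d) : hpow Hk d :=
  bochner P0 (X : set (rVborel R d))
    (fun x => tensor (stein_feature x) (stein_feature x) f).

End stein.

Arguments stein_covariance {R d X k} Hk p0 P0 f.

Section iid.
Context (R : realType) (d : nat) (X : set 'rV[R]_d).
Context (dO : measure_display) (Omega : measurableType dO).
Context (W : probability Omega R) (n : nat).

Definition mutually_independent (Z : 'I_n -> Omega -> rVborel R d) :=
  forall (J : {set 'I_n}) (A : 'I_n -> set (rVborel R d)),
    (forall i, measurable (A i)) ->
    W (\bigcap_(i in [set` J]) (Z i @^-1` A i)) =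
      (\prod_(i in J) W (Z i @^-1` A i))%E.

Definition iid_sample (P : probability (rVborel R d) R)
    (Z : 'I_n -> Omega -> rVborel R d) :=
  [/\ forall i, measurable_fun setT (Z i),
      forall i w, X (Z i w),
      forall i (A : set (rVborel R d)), measurable A ->
        W (Z i @^-1` A) = P A &
      mutually_independent Z].

End iid.

(* Main.v *)
Require Import Defs.
From mathcomp Require Import all_boot all_order all_algebra finmap.
From mathcomp Require Import all_classical all_reals all_analysis.
From mathcomp Require Import ring lra.
Import Order.TTheory GRing.Theory Num.Theory.
Import numFieldNormedType.Exports measurable_realfun.

(* The Stein feature map is norm-continuous on X: the RKHS contains the partial
   derivatives of the kernel, as limits of difference quotients whose inner
   products are mixed second differences of k.  Base points are taken in the
   interior of X, which reaches the boundary points of X as well.  Hence the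
   feature map f is a pointwise limit of simple functions s_m with
   |f - s_m| <= |f|.  For a simple function the bound is a computation with
   finite sums: by Jensen, E| |mean| - |mu| | <= (E|mean - mu|^2)^(1/2), and
   independence kills the cross terms, which leaves the variance over n.  Fatou's
   lemma on the left and dominated convergence on the right pass to f.  At the
   target mu = 0, and the trace equals E|f|^2 by Parseval, exchanging sum and
   integral over the countably many basis vectors that f does not annihilate. *)

Set Implicit Arguments.
Unset Strict Implicit.
Unset Printing Implicit Defensive.

Local Open Scope classical_set_scope.
Local Open Scope ring_scope.

(** * Hilbert spaces *)

(** Independence is given on events, so for a general feature map the vanishing of the cross terms
    is not immediate. For a simple map the sample reduces to the labels of its finitely many values;
    their joint law is a finite table, and products of events are all that is needed. This dictates
    what the approximants must satisfy. They converge at every point of [X], hence along every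
    sample path. Their norms are at most twice that of the limit, so second moments converge. Their
    integrals tend to the vector that [bochner] selects by [xget]; this is settled by showing that
    the inner products of a Bochner integral with all vectors are forced, so that it is unique. The
    Hilbert space is not assumed separable. Separability enters through the range of the map only,
    as a countable family of vectors that comes arbitrarily close to each value. The same family
    feeds the approximants and, for the trace, cuts a possibly uncountable orthonormal basis down to
    a countable part. *)

Section hilbert_basics.
Context (R : realType) (H : hilbert R).
Implicit Types u v w : H.

Lemma dotDl u v w : dot (u + v) w = dot u w + dot v w.
Proof. by have := dotPl 1 u v w; rewrite scale1r mul1r. Qed.

Lemma dot0l w : dot (0 : H) w = 0.
Proof. by apply: (addrI (dot 0 w)); rewrite -dotDl !addr0. Qed.

Lemma dotZl (a : R) u w : dot (a *: u) w = a * dot u w.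
Proof. by have := dotPl a u 0 w; rewrite addr0 dot0l addr0. Qed.

Lemma dotNl u w : dot (- u) w = - dot u w.
Proof. by rewrite -scaleN1r dotZl mulN1r. Qed.

Lemma dotBl u v w : dot (u - v) w = dot u w - dot v w.
Proof. by rewrite dotDl dotNl. Qed.

Lemma dot0r w : dot w (0 : H) = 0.
Proof. by rewrite dotC dot0l. Qed.

Lemma dotDr u v w : dot w (u + v) = dot w u + dot w v.
Proof. by rewrite dotC dotDl !(dotC w). Qed.

Lemma dotZr (a : R) u w : dot w (a *: u) = a * dot w u.
Proof. by rewrite dotC dotZl (dotC w). Qed.

Lemma dotBr u v w : dot w (u - v) = dot w u - dot w v.
Proof. by rewrite dotC dotBl !(dotC w). Qed.

Lemma dot_suml I (r : seq I) (P : pred I) (F : I -> H) w :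
  dot (\sum_(i <- r | P i) F i) w = \sum_(i <- r | P i) dot (F i) w.
Proof.
apply: (big_morph (fun u => dot u w)); last exact: dot0l.
by move=> u v; exact: dotDl.
Qed.

Lemma dot_sumr I (r : seq I) (P : pred I) (F : I -> H) w :
  dot w (\sum_(i <- r | P i) F i) = \sum_(i <- r | P i) dot w (F i).
Proof. by rewrite dotC dot_suml; apply: eq_bigr => i _; exact: dotC. Qed.

Lemma hnorm_ge0 u : 0 <= hnorm u.
Proof. exact: sqrtr_ge0. Qed.

Lemma hnorm_sqr u : hnorm u ^+ 2 = dot u u.
Proof. by rewrite sqr_sqrtr// dot_ge0. Qed.

Lemma hnorm0 : hnorm (0 : H) = 0.
Proof. by rewrite /hnorm dot0l sqrtr0. Qed.

Lemma hnorm0_eq0 u : hnorm u = 0 -> u = 0.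
Proof. by move=> u0; apply: dot_eq0; rewrite -hnorm_sqr u0 expr0n. Qed.

Lemma dot_sqr_le u v : dot u v ^+ 2 <= dot u u * dot v v.
Proof.
have [->|v0] := eqVneq v 0; first by rewrite !dot0r mulr0 expr0n.
have vp : 0 < dot v v.
  by rewrite lt_neqAle dot_ge0 andbT eq_sym; apply/eqP => /dot_eq0; exact/eqP.
have := dot_ge0 (dot v v *: u - dot u v *: v).
rewrite dotBl !dotZl !dotBr !dotZr (dotC v u) => h.
rewrite -subr_ge0 -(pmulr_rge0 _ vp); apply: le_trans h _.
by rewrite le_eqVlt; apply/orP; left; apply/eqP; ring.
Qed.

Lemma normr_dot_le u v : `|dot u v| <= hnorm u * hnorm v.
Proof.
rewrite -ler_sqr ?nnegrE ?mulr_ge0 ?hnorm_ge0// real_normK ?num_real//.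
by rewrite exprMn !hnorm_sqr dot_sqr_le.
Qed.

Lemma hnormD u v : hnorm (u + v) <= hnorm u + hnorm v.
Proof.
rewrite -ler_sqr ?nnegrE ?addr_ge0 ?hnorm_ge0// sqrrD !hnorm_sqr.
rewrite dotDl !dotDr (dotC v u).
have := le_trans (ler_norm _) (normr_dot_le u v); lra.
Qed.

Lemma hnormZ (a : R) u : hnorm (a *: u) = `|a| * hnorm u.
Proof. by rewrite /hnorm dotZl dotZr mulrA -expr2 sqrtrM ?sqr_ge0// sqrtr_sqr. Qed.

Lemma hnormN u : hnorm (- u) = hnorm u.
Proof. by rewrite -scaleN1r hnormZ normrN1 mul1r. Qed.

Lemma hdistC u v : hnorm (u - v) = hnorm (v - u).
Proof. by rewrite -hnormN opprB. Qed.

Lemma hnormB u v : hnorm (u - v) <= hnorm u + hnorm v.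
Proof. by rewrite -(hnormN v) hnormD. Qed.

Lemma hdist_triangle w u v : hnorm (u - v) <= hnorm (u - w) + hnorm (w - v).
Proof. by rewrite -[u - v](subrKA w) hnormD. Qed.

Lemma ler_dist_hnorm u v : `|hnorm u - hnorm v| <= hnorm (u - v).
Proof.
rewrite ler_norml; have := hnormD (u - v) v; have := hnormD (v - u) u.
by rewrite !subrK (hdistC v u); lra.
Qed.

Lemma hdist_sqr u v : hnorm (u - v) ^+ 2 = dot u u - 2 * dot u v + dot v v.
Proof. by rewrite hnorm_sqr dotBl !dotBr (dotC v u); ring. Qed.

End hilbert_basics.

Section hilbert_limits.
Context (R : realType) (H : hilbert R) (T : Type) (F : set_system T).
Context {FF : Filter F}.
Implicit Types (f g : T -> H) (u v : H).

(** The filter is arbitrary so that one notion covers sequences ([\oo]) and continuity relative to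
    [X] ([within X (nbhs x)]). *)
Definition hcvg f u := hnorm (f x - u) @[x --> F] --> (0 : R).

Lemma hcvg_le f u (b : T -> R) : (\forall x \near F, hnorm (f x - u) <= b x) ->
  b x @[x --> F] --> (0 : R) -> hcvg f u.
Proof.
move=> fb b0; apply: (@squeeze_cvgr _ _ _ _ (fun=> 0) b); [|exact: cvg_cst|exact: b0].
by near=> x; rewrite hnorm_ge0/=; near: x.
Unshelve. all: by end_near. Qed.

Lemma hcvg_sqr f u :
  dot (f x - u) (f x - u) @[x --> F] --> (0 : R) -> hcvg f u.
Proof.
move=> f0; rewrite /hcvg -[X in _ --> X]sqrtr0; apply: continuous_cvg => //.
exact: sqrt_continuous.
Qed.

Lemma hcvg_cst u : hcvg (fun=> u) u.
Proof. by rewrite /hcvg subrr hnorm0; exact: cvg_cst. Qed.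

Lemma hcvgD f g u v : hcvg f u -> hcvg g v -> hcvg (fun x => f x + g x) (u + v).
Proof.
move=> fu gv; apply: (@hcvg_le _ _ (fun x => hnorm (f x - u) + hnorm (g x - v))).
  by apply: nearW => x; rewrite opprD addrACA hnormD.
by rewrite -[X in _ --> X](addr0 (0:R)); apply: cvgD.
Qed.

Lemma hcvg_sum (I : Type) (r : seq I) (f : I -> T -> H) (u : I -> H) :
  (forall i, hcvg (f i) (u i)) ->
  hcvg (fun x => \sum_(i <- r) f i x) (\sum_(i <- r) u i).
Proof.
move=> fu; elim: r => [|i r IHr].
  by rewrite big_nil; under eq_fun do rewrite big_nil; exact: hcvg_cst.
by rewrite big_cons; under eq_fun do rewrite big_cons; exact: hcvgD.
Qed.

Lemma hcvgZl (a : R) f u : hcvg f u -> hcvg (fun x => a *: f x) (a *: u).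
Proof.
move=> fu; apply: (@hcvg_le _ _ (fun x => `|a| * hnorm (f x - u))).
  by apply: nearW => x; rewrite -scalerBr hnormZ.
by rewrite -[X in _ --> X](mulr0 `|a|); apply: cvgM => //; exact: cvg_cst.
Qed.

Lemma hcvgB f g u v : hcvg f u -> hcvg g v -> hcvg (fun x => f x - g x) (u - v).
Proof.
move=> fu /(hcvgZl (-1)); rewrite scaleN1r => gv; apply: hcvgD fu _.
by move: gv; rewrite /hcvg; under eq_fun do rewrite scaleN1r.
Qed.

Lemma hcvgZ (a : T -> R) (l : R) f u : a x @[x --> F] --> l -> hcvg f u ->
  hcvg (fun x => a x *: f x) (l *: u).
Proof.
move=> al fu; apply: (@hcvg_le _ _
  (fun x => `|a x| * hnorm (f x - u) + `|a x - l| * hnorm u)).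
  apply: nearW => x; rewrite -!hnormZ.
  rewrite (_ : _ - _ = a x *: (f x - u) + (a x - l) *: u); first exact: hnormD.
  by rewrite scalerBr scalerBl addrA subrK.
rewrite -[X in _ --> X](addr0 (0 : R)) -[X in _ --> X + _](mulr0 `|l|).
rewrite -[X in _ --> _ + X](mul0r (hnorm u)); apply: cvgD; apply: cvgM => //.
- exact: cvg_norm.
- rewrite -[X in _ --> X](@normr0 _ R) -(subrr l); apply: cvg_norm.
  by apply: cvgB => //; exact: cvg_cst.
- exact: cvg_cst.
Qed.

Lemma hcvg_norm f u : hcvg f u -> hnorm (f x) @[x --> F] --> hnorm u.
Proof.
move=> fu; apply/cvgrPdist_lt => e e0; move/cvgrPdist_lt : fu => /(_ e e0).
apply: filterS => x; rewrite sub0r normrN ger0_norm ?hnorm_ge0// hdistC.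
by apply: le_lt_trans; exact: ler_dist_hnorm.
Qed.

Lemma hcvg_dotl f u w : hcvg f u -> dot (f x) w @[x --> F] --> dot u w.
Proof.
move=> fu; apply/cvgrPdist_le => e e0.
have e1 : 0 < e / (hnorm w + 1) by rewrite divr_gt0// ltr_wpDl// hnorm_ge0.
move/cvgrPdist_lt : fu => /(_ _ e1).
apply: filterS => x; rewrite sub0r normrN ger0_norm ?hnorm_ge0// => fx.
rewrite distrC -dotBl (le_trans (normr_dot_le _ _))//.
have w1 : 0 < hnorm w + 1 by rewrite ltr_wpDl ?hnorm_ge0.
move: fx; rewrite ltr_pdivlMr// => /ltW; apply: le_trans.
by rewrite ler_wpM2l ?hnorm_ge0// lerDl.
Qed.

(** Polarization reduces joint convergence to convergence of norms. *)
Lemma hcvg_dot f g u v : hcvg f u -> hcvg g v ->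
  dot (f x) (g x) @[x --> F] --> dot u v.
Proof.
move=> fu gv.
have P (a b : H) : dot a b = (hnorm (a + b) ^+ 2 - hnorm a ^+ 2 - hnorm b ^+ 2) / 2.
  by rewrite !hnorm_sqr dotDl !dotDr (dotC b a); field.
rewrite P; under eq_fun do rewrite P.
have sq (h : T -> H) w : hcvg h w -> hnorm (h x) ^+ 2 @[x --> F] --> hnorm w ^+ 2.
  by move=> /hcvg_norm hw; under eq_fun do rewrite expr2; rewrite expr2; exact: cvgM.
apply: cvgM; last exact: cvg_cst.
by apply: cvgB; [apply: cvgB|]; apply: sq => //; exact: hcvgD.
Qed.

End hilbert_limits.

(** Expanding the square of [hnorm (u m - u n)] gives inner products with weights 1, -2, 1, whose
    limits [L - 2 * L + L] cancel. The total weight 4 explains the tolerance [e ^+ 2 / 4]. *)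
Lemma hcvg_double (R : realType) (H : hilbert R) (u : nat -> H) (L : R) :
  (forall e : R, 0 < e -> exists N, forall m n, (N <= m)%N -> (N <= n)%N ->
    `|dot (u m) (u n) - L| < e) -> exists l, hcvg \oo u l.
Proof.
move=> uL; apply: dot_complete => e e0.
have e4 : 0 < e ^+ 2 / 4 by rewrite divr_gt0// exprn_gt0.
have [N uN] := uL _ e4; exists N => m n Nm Nn.
rewrite -/(hnorm _) -ltr_sqr ?nnegrE ?hnorm_ge0 ?ltW// hdist_sqr.
have := uN m m Nm Nm; have := uN m n Nm Nn; have := uN n n Nn Nn.
by rewrite !ltr_norml; lra.
Qed.

(** * Derivatives of a reproducing kernel *)

Lemma is_derive_line (R : realType) (V : normedModType R) (f : V -> R) (x v : V)
    (t : R) : derivable f (x + t *: v) v ->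
  is_derive t 1 (fun s : R => f (x + s *: v)) ('D_v f (x + t *: v)).
Proof.
have E : (fun h : R => h^-1 *: (((fun s : R => f (x + s *: v)) \o shift t) (h *: (1:R))
           - f (x + t *: v))) =
         (fun h : R => h^-1 *: ((f \o shift (x + t *: v)) (h *: v) - f (x + t *: v))).
  apply/funext => h /=; congr (_ *: (f _ - _)).
  by rewrite scalerDl [h *: 1]mulr1 addrCA.
by move=> fd; split; [rewrite /derivable E|rewrite /derive E].
Qed.

Lemma mvt_line (R : realType) (V : normedModType R) (f : V -> R) (x v : V) (h : R) :
  0 < h -> (forall t, 0 <= t <= h -> derivable f (x + t *: v) v) ->
  exists2 t, 0 <= t <= h &
    f (x + h *: v) - f x = h * 'D_v f (x + t *: v).
Proof.
move=> h0 fd.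
have gd (t : R) : 0 <= t <= h ->
    is_derive t 1 (fun s : R => f (x + s *: v)) ('D_v f (x + t *: v)).
  by move=> /fd; exact: is_derive_line.
have [t||c] := @MVT R (fun s => f (x + s *: v)) (fun s => 'D_v f (x + s *: v)) 0 h h0.
- by rewrite in_itv/= => /andP[t0 th]; apply: gd; rewrite !ltW.
- apply: derivable_within_continuous => t; rewrite in_itv/= => th.
  by have [] := gd _ th.
- rewrite in_itv/= scale0r addr0 subr0 mulrC => /andP[c0 ch] ->.
  by exists c => //; rewrite !ltW.
Qed.

Section mixed_difference.
Context (R : realType) (d : nat).
Implicit Types (U : set 'rV[R]_d) (x y : 'rV[R]_d).

(** The mean value theorem is applied twice: in the second variable to the difference of
    [k (x + s *: e_i)] and [k x], then in the first variable to [pderiv2 j k] at the point found. *)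
Lemma mvt_mixed U (k : 'rV[R]_d -> 'rV[R]_d -> R) (i j : 'I_d) x y (s t : R) :
  C11_on U k -> 0 < s -> 0 < t ->
  (forall r, 0 <= r <= s -> U (x + r *: basis_rV R i)) ->
  (forall r, 0 <= r <= t -> U (y + r *: basis_rV R j)) ->
  exists a b : R, [/\ 0 <= a <= s, 0 <= b <= t &
    k (x + s *: basis_rV R i) (y + t *: basis_rV R j) - k x (y + t *: basis_rV R j)
      - k (x + s *: basis_rV R i) y + k x y =
    s * t * pderiv1 i (pderiv2 j k) (x + a *: basis_rV R i) (y + b *: basis_rV R j)].
Proof.
move=> [_ _ [dk2 _] [dk12 _]] s0 t0 Ux Uy.
set ei := basis_rV R i; set ej := basis_rV R j.
have Ux0 : U x by rewrite -[x]addr0 -(scale0r ei); apply: Ux; rewrite lexx ltW.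
have Uxs : U (x + s *: ei) by apply: Ux; rewrite lexx ltW.
have [b bt Eb] : exists2 b, 0 <= b <= t &
    (k (x + s *: ei) (y + t *: ej) - k x (y + t *: ej)) -
    (k (x + s *: ei) y - k x y) =
    t * (pderiv2 j k (x + s *: ei) (y + b *: ej) - pderiv2 j k x (y + b *: ej)).
  have [|b bt ->] := @mvt_line _ _ (k (x + s *: ei) \- k x) y ej t t0.
    by move=> r rt; apply: derivableB; apply: dk2 => //; exact: Uy.
  exists b => //; rewrite deriveB//; apply: dk2 => //; exact: Uy.
have [|a as_ Ea] := @mvt_line _ _ (fun x' => pderiv2 j k x' (y + b *: ej)) x ei s s0.
  by move=> r rs; apply: dk12; [exact: Ux|exact: Uy].
exists a, b; split => //; move: Eb; rewrite Ea => Eb.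
rewrite opprB addrA in Eb.
by rewrite mulrAC mulrC -Eb; ring.
Qed.

End mixed_difference.

Lemma joint_continuity_dist (R : realType) (V : normedModType R) (U : set V)
    (g : V -> V -> R) (x y : V) : open U -> U x -> U y ->
  {in U `*` U, continuous (fun z : V * V => g z.1 z.2)} ->
  forall e : R, 0 < e -> exists2 r, 0 < r & forall a b, `|x - a| < r -> `|y - b| < r ->
    [/\ U a, U b & `|g x y - g a b| < e].
Proof.
move=> oU Ux Uy gc e e0.
have /cvgrPdist_lt/(_ _ e0) gxy : g z.1 z.2 @[z --> (x, y)] --> g x y.
  by apply: (gc (x, y)); rewrite inE.
have Uxy : \forall z \near (x, y), (U `*` U) z.
  by exists (U, U) => //=; split; apply: open_nbhs_nbhs.
have : nbhs (x, y) [set z : V * V | `|g x y - g z.1 z.2| < e /\ (U `*` U) z].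
  exact: filterI gxy Uxy.
move=> /nbhs_ballP[r /= r0 rP].
exists r => // a b xa yb; have /= [|] := rP (a, b).
  by split; rewrite /= -ball_normE.
by move=> gab [].
Qed.

(** The squared distance from [F z] to [F x] is [g z z - g z x - g x z + g x x], which tends to 0 by
    joint continuity of [g] at [(x, x)]. The limit is taken within [X] because [g] gives the inner
    products only there. *)
Lemma hcvg_kernel (R : realType) (V : normedModType R) (X U : set V) (H : hilbert R)
    (F : V -> H) (g : V -> V -> R) (x : V) : open U -> X `<=` U ->
  (forall x y, X x -> X y -> dot (F x) (F y) = g x y) ->
  {in U `*` U, continuous (fun z : V * V => g z.1 z.2)} ->
  X x -> hcvg (within X (nbhs x)) F (F x).
Proof.
move=> oU XU Fg gc Xx; apply: hcvg_sqr; apply/cvgrPdist_lt => e e0.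
have Ux := XU _ Xx; have e4 : 0 < e / 4 by rewrite divr_gt0.
have [r r0 rP] := joint_continuity_dist oU Ux Ux gc e4.
rewrite near_withinE; near=> z => Xz.
have xz : `|x - z| < r.
  by near: z; apply: (@cvgr_dist_lt _ _ _ (nbhs x) _ id x) => //; exact: cvg_id.
have x0 : `|x - x| < r by rewrite subrr normr0.
have [_ _] := rP z x xz x0; have [_ _] := rP x z x0 xz; have [_ _] := rP z z xz xz.
by rewrite dotBl !dotBr !Fg// !ltr_norml; lra.
Unshelve. all: by end_near. Qed.

Section rkhs_derivatives.
Context (R : realType) (d : nat) (X U : set 'rV[R]_d) (k : 'rV[R]_d -> 'rV[R]_d -> R).
Context (Hk : rkhs X k).
Hypotheses (oU : open U) (XU : X `<=` U) (Xreg : X `<=` closure (interior X)).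
Hypothesis k_C11 : C11_on U k.
Implicit Types x y z : 'rV[R]_d.

Local Notation e_ i := (basis_rV R i).

(** Exhibiting one element with the values of [g] on [X] rules out the default 0 of [xget], and
    injectivity of evaluation identifies the choice. *)
Lemma rk_eltE g (f : Hk) : (forall y, X y -> rk_eval f y = g y) -> rk_elt Hk g = f.
Proof.
move=> fg; apply: (@rk_eval_inj _ _ _ _ Hk) => y Xy; rewrite fg//.
by rewrite /rk_elt; case: xgetP => [h _ /(_ y Xy)|/(_ f)].
Qed.

Definition rk_ker x : Hk := rk_elt Hk (k x).

Lemma rk_ker_reproducing x (f : Hk) : X x -> rk_eval f x = dot f (rk_ker x).
Proof.
move=> Xx; have [kx kxE kxP] := rk_reproducing Hk Xx.
by rewrite /rk_ker (rk_eltE kxE) kxP.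
Qed.

Lemma rk_ker_eval x y : X x -> X y -> rk_eval (rk_ker x) y = k x y.
Proof.
move=> Xx Xy; have [kx kxE kxP] := rk_reproducing Hk Xx.
by rewrite /rk_ker (rk_eltE kxE) kxE.
Qed.

Lemma dot_rk_ker x y : X x -> X y -> dot (rk_ker x) (rk_ker y) = k x y.
Proof. by move=> Xx Xy; rewrite -rk_ker_reproducing// rk_ker_eval. Qed.

(* [p n = (z, h)] is the base point and the step of a difference quotient in
   direction [i]; the point [x] itself may be on the boundary of [X]. *)
Definition direction_approx i x (p : nat -> 'rV[R]_d * R) :=
  forall n, [/\ X (p n).1, 0 < (p n).2, X ((p n).1 + (p n).2 *: e_ i),
    `|x - (p n).1| < n.+1%:R^-1 & (p n).2 * `|e_ i| < n.+1%:R^-1].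

Lemma direction_approx_ex i x : X x -> exists p, direction_approx i x p.
Proof.
move=> /Xreg Xx.
suff /choice[p pP] : forall n : nat, exists zh : 'rV[R]_d * R,
    [/\ X zh.1, 0 < zh.2, X (zh.1 + zh.2 *: e_ i),
        `|x - zh.1| < n.+1%:R^-1 & zh.2 * `|e_ i| < n.+1%:R^-1] by exists p.
move=> n; have n0 : 0 < n.+1%:R^-1 :> R by rewrite invr_gt0.
have [z [Xz xz]] := Xx _ (nbhsx_ballx x _ n0).
have /nbhs_ballP[r /= r0 rP] := Xz.
have ei0 : 0 < 1 + `|e_ i| by rewrite ltr_wpDr.
pose m := Num.min r n.+1%:R^-1; have m0 : 0 < m by rewrite lt_min r0.
(* The summand 1 keeps the denominator positive without computing the norm of [e_ i]; the factor 1/2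
   makes [h * (1 + |e_ i|)] strictly smaller than [m]. *)
pose h := m / 2 / (1 + `|e_ i|); have h0 : 0 < h by rewrite !divr_gt0.
have hm : h * `|e_ i| < m.
  have : h * (1 + `|e_ i|) = m / 2 by rewrite /h divfK// gt_eqF.
  rewrite mulrDr mulr1; lra.
move: (hm); rewrite lt_min => /andP[hr hn]; exists (z, h); split => //=.
- by apply: rP; exact: ballxx.
- apply: rP; rewrite -ball_normE/= opprD addrA subrr sub0r normrN normrZ.
  by rewrite (gtr0_norm h0).
- by move: xz; rewrite -ball_normE.
Qed.

(** The whole segment of a difference quotient tends to [x], so the intermediate points of the mean
    value theorem end up near [x] and in [U], although only the endpoints are known to lie in
    [X]. *)
Lemma direction_approx_near i x p r : direction_approx i x p -> 0 < r ->
  exists N, forall n, (N <= n)%N -> forall a, 0 <= a <= (p n).2 ->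
    `|x - ((p n).1 + a *: e_ i)| < r.
Proof.
move=> xp r0; have r2 : 0 < r / 2 by rewrite divr_gt0.
have [N NP] := filter_ex (near_infty_natSinv_lt (PosNum r2)).
exists N => n Nn a /andP[a0 ap]; have [_ p0 _ xpn pe] := xp n.
have nN : n.+1%:R^-1 <= N.+1%:R^-1 :> R by rewrite lef_pV2 ?posrE// ler_nat.
rewrite opprD addrA (le_lt_trans (ler_normB _ _))// normrZ (ger0_norm a0).
have : a * `|e_ i| <= (p n).2 * `|e_ i| by rewrite ler_wpM2r.
have nr : n.+1%:R^-1 < r / 2 by exact: le_lt_trans nN NP.
rewrite [r]splitr ltrD ?(lt_trans xpn)//.
by rewrite (le_lt_trans (ler_wpM2r _ ap))// (lt_trans pe).
Qed.

Definition diff_quotient i (p : 'rV[R]_d * R) : Hk :=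
  p.2^-1 *: (rk_ker (p.1 + p.2 *: e_ i) - rk_ker p.1).

(** The inner product is a mixed difference of [k] divided by both steps, hence a value of the mixed
    derivative near [(x, y)]. The indices [m] and [n] are independent: with equal data on both sides
    this is the criterion of [hcvg_double], with different data it yields [dot_rk_pderiv]. *)
Lemma dot_diff_quotients i j x y p q : X x -> X y ->
  direction_approx i x p -> direction_approx j y q ->
  forall e : R, 0 < e -> exists N, forall m n, (N <= m)%N -> (N <= n)%N ->
    `|dot (diff_quotient i (p m)) (diff_quotient j (q n)) -
      pderiv1 i (pderiv2 j k) x y| < e.
Proof.
move=> Xx Xy xp yq e e0; have [_ _ _ [_ cM]] := k_C11.
have [r r0 rP] := joint_continuity_dist oU (XU Xx) (XU Xy) (cM i j) e0.
have [N1 N1P] := direction_approx_near xp r0.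
have [N2 N2P] := direction_approx_near yq r0.
exists (maxn N1 N2) => m n; rewrite !geq_max => /andP[N1m N2m] /andP[N1n N2n].
have y0 : `|y - y| < r by rewrite subrr normr0.
have x0 : `|x - x| < r by rewrite subrr normr0.
have [Xz s0 Xzs _ _] := xp m; have [Xw t0 Xwt _ _] := yq n.
have [a [b [as_ bt E]]] := @mvt_mixed _ _ U k i j (p m).1 (q n).1 (p m).2 (q n).2
  k_C11 s0 t0 (fun a am => let: And3 Ua _ _ := rP _ _ (N1P m N1m a am) y0 in Ua)
  (fun b bn => let: And3 _ Ub _ := rP _ _ x0 (N2P n N2n b bn) in Ub).
have [_ _] := rP _ _ (N1P m N1m a as_) (N2P n N2n b bt).
rewrite distrC /diff_quotient dotZl dotZr dotBl !dotBr !dot_rk_ker//.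
rewrite (_ : _ * _ = pderiv1 i (pderiv2 j k) ((p m).1 + a *: e_ i) ((q n).1 + b *: e_ j))//.
have -> (u v w z : R) : u - v - (w - z) = u - w - v + z by ring.
by rewrite E; field; rewrite !gt_eqF.
Qed.

Lemma dot_diff_quotient_ker i x y p : X x -> X y -> direction_approx i x p ->
  dot (diff_quotient i (p n)) (rk_ker y) @[n --> \oo] --> pderiv1 i k x y.
Proof.
move=> Xx Xy xp; apply/cvgrPdist_lt => e e0; have [_ [dk1 ck1] _ _] := k_C11.
have [r r0 rP] := joint_continuity_dist oU (XU Xx) (XU Xy) (ck1 i) e0.
have y0 : `|y - y| < r by rewrite subrr normr0.
have [N NP] := direction_approx_near xp r0; exists N => // n /= Nn.
have [Xz s0 Xzs _ _] := xp n.
have [|a as_ E] := @mvt_line _ _ (k^~ y) (p n).1 (e_ i) (p n).2 s0.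
  move=> a an; apply: dk1; last exact: XU.
  by have [] := rP _ _ (NP n Nn a an) y0.
have [_ _] := rP _ _ (NP n Nn a as_) y0.
by rewrite /diff_quotient dotZl dotBl !dot_rk_ker// E mulKf ?gt_eqF.
Qed.

Definition rk_pderiv i x : Hk := rk_elt Hk (pderiv1 i k x).

(** A limit [l] exists by [hcvg_double]. Its inner product with [rk_ker y] is its value at [y] and
    also the limit of ordinary difference quotients, so [l] is the partial derivative as an element
    of the RKHS. *)
Lemma diff_quotient_cvg i x p : X x -> direction_approx i x p ->
  hcvg \oo (fun n => diff_quotient i (p n)) (rk_pderiv i x) /\
  (forall y, X y -> rk_eval (rk_pderiv i x) y = pderiv1 i k x y).
Proof.
move=> Xx xp; have [l gl] := hcvg_double (dot_diff_quotients Xx Xx xp xp).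
have lE y : X y -> rk_eval l y = pderiv1 i k x y.
  move=> Xy; rewrite rk_ker_reproducing//.
  apply: (@norm_cvg_unique R R^o
    (dot (diff_quotient i (p n)) (rk_ker y) @[n --> \oo])).
    exact: hcvg_dotl.
  exact: dot_diff_quotient_ker.
by rewrite /rk_pderiv (rk_eltE lE).
Qed.

Lemma rk_pderiv_eval i x y : X x -> X y ->
  rk_eval (rk_pderiv i x) y = pderiv1 i k x y.
Proof.
move=> Xx; have [p xp] := direction_approx_ex i Xx.
by have [_] := diff_quotient_cvg Xx xp; exact.
Qed.

Lemma dot_rk_pderiv i j x y : X x -> X y ->
  dot (rk_pderiv i x) (rk_pderiv j y) = pderiv1 i (pderiv2 j k) x y.
Proof.
move=> Xx Xy; have [p xp] := direction_approx_ex i Xx.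
have [q yq] := direction_approx_ex j Xy.
have [xc _] := diff_quotient_cvg Xx xp; have [yc _] := diff_quotient_cvg Xy yq.
apply: (@norm_cvg_unique R R^o
  (dot (diff_quotient i (p n)) (diff_quotient j (q n)) @[n --> \oo])).
  exact: hcvg_dot.
apply/cvgrPdist_lt => e /(dot_diff_quotients Xx Xy xp yq)[N NP].
by exists N => // n /= Nn; rewrite distrC; exact: NP.
Qed.

Lemma rk_ker_continuous x : X x -> hcvg (within X (nbhs x)) rk_ker (rk_ker x).
Proof.
have [ck _ _ _] := k_C11.
exact: (hcvg_kernel oU XU (fun x y => @dot_rk_ker x y) ck).
Qed.

Lemma rk_pderiv_continuous i x : X x ->
  hcvg (within X (nbhs x)) (rk_pderiv i) (rk_pderiv i x).
Proof.
have [_ _ _ [_ cM]] := k_C11.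
exact: (hcvg_kernel oU XU (fun x y => @dot_rk_pderiv i i x y) (cM i i)).
Qed.

End rkhs_derivatives.

(** * Continuity of the score and of the Stein feature map *)

Lemma hcvg_hpow (R : realType) (H : hilbert R) (d : nat) (T : Type)
    (F : set_system T) {FF : Filter F} (f : T -> hpow H d) (u : hpow H d) :
  (forall i : 'I_d, hcvg F (fun x => (f x : {ffun 'I_d -> H}) i)
     ((u : {ffun 'I_d -> H}) i)) -> hcvg F f u.
Proof.
move=> fu; apply: hcvg_sqr.
rewrite [X in X @ _](_ : _ = fun x => \sum_(i < d)
    hnorm ((f x : {ffun 'I_d -> H}) i - (u : {ffun 'I_d -> H}) i) ^+ 2); last first.
  by apply/funext => x; apply: eq_bigr => i _; rewrite !ffunE hnorm_sqr.
rewrite [X in _ --> X](_ : _ = \sum_(i < d) (0 ^+ 2 : R)); last first.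
  by rewrite big1// => i _; rewrite expr0n.
apply: cvg_big => [|i _]; [exact: add_continuous|]; rewrite expr2.
under eq_fun do rewrite expr2.
by apply: cvgM; exact: fu.
Qed.

Lemma score_continuous (R : realType) (d : nat) (U : set 'rV[R]_d) (p0 : 'rV[R]_d -> R)
    (i : 'I_d) (x : 'rV[R]_d) : open U -> C1_on U p0 -> U x -> 0 < p0 x ->
  score p0 z i @[z --> x] --> score p0 x i.
Proof.
move=> oU [dp cp] Ux p0x.
have scoreE z : U z -> 0 < p0 z -> score p0 z i = (p0 z)^-1 * 'D_(basis_rV R i) p0 z.
  move=> Uz p0z; have dz := dp _ Uz; have lnz := is_derive1_ln p0z.
  have dln : differentiable (@ln R) (p0 z) by apply/derivable1_diffP; case: lnz.
  rewrite /score deriveE; last exact: differentiable_comp.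
  rewrite diff_comp//= [in RHS]deriveE//; set w := 'd p0 z _.
  have -> : 'd (@ln R) (p0 z) w = w *: 'd (@ln R) (p0 z) 1.
    by rewrite -linearZ/= [w *: 1]mulr1.
  rewrite -deriveE// (@derive_val _ _ _ _ _ _ _ lnz).
  exact: mulrC.
rewrite scoreE//.
have pc : p0 z @[z --> x] --> p0 x by exact/differentiable_continuous/dp.
have pVc : (p0 z)^-1 @[z --> x] --> (p0 x)^-1.
  by apply: (@cvgV R _ (nbhs x) _ p0) => //; rewrite gt_eqF.
have dpc : 'D_(basis_rV R i) p0 z @[z --> x] --> 'D_(basis_rV R i) p0 x.
  by apply: cp; rewrite inE.
(* The density is assumed positive on [X] only; near [x] it is positive by continuity, so the
   quotient formula holds on a full neighbourhood. *)
apply: cvg_trans (cvgM (FF := nbhs_filter x) pVc dpc).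
apply: (@near_eq_cvg _ _ (nbhs x)); near=> z.
rewrite scoreE//; near: z; first exact: open_nbhs_nbhs.
exact: (cvgr_gt _ pc).
Unshelve. all: by end_near. Qed.

Section stein_feature_continuity.
Context (R : realType) (d : nat) (X U : set 'rV[R]_d) (k : 'rV[R]_d -> 'rV[R]_d -> R).
Context (Hk : rkhs X k) (p0 : 'rV[R]_d -> R).
Hypotheses (oU : open U) (XU : X `<=` U) (Xreg : X `<=` closure (interior X)).
Hypothesis k_C11 : C11_on U k.
Hypotheses (p0_C1 : C1_on U p0) (p0_gt0 : forall x, X x -> 0 < p0 x).

(** Since kernel sections and their derivatives belong to the RKHS, the [rk_elt] in the feature map
    is a genuine linear combination and not a default value. *)
Lemma stein_featureE x i : X x -> (stein_feature Hk p0 x : {ffun 'I_d -> Hk}) i =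
  score p0 x i *: rk_ker Hk x + rk_pderiv Hk i x.
Proof.
move=> Xx; rewrite ffunE; apply: rk_eltE => y Xy.
rewrite rk_evalP// rk_ker_eval//.
by rewrite (rk_pderiv_eval Hk oU XU Xreg k_C11).
Qed.

Lemma stein_feature_continuous x : X x ->
  hcvg (within X (nbhs x)) (stein_feature Hk p0) (stein_feature Hk p0 x).
Proof.
move=> Xx; apply: hcvg_hpow => i; rewrite stein_featureE//.
have : hcvg (within X (nbhs x)) (fun z => score p0 z i *: rk_ker Hk z + rk_pderiv Hk i z)
    (score p0 x i *: rk_ker Hk x + rk_pderiv Hk i x).
  apply: hcvgD; last exact: (rk_pderiv_continuous Hk oU XU Xreg k_C11).
  apply: hcvgZ; last exact: (rk_ker_continuous Hk oU XU k_C11).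
  apply: cvg_within_filter; apply: (score_continuous oU p0_C1); first exact: XU.
  exact: p0_gt0.
apply: cvg_trans; apply: near_eq_cvg; rewrite near_withinE; near=> z => Xz.
by rewrite stein_featureE.
Unshelve. all: by end_near. Qed.

End stein_feature_continuity.

(** * Bochner integration of strongly measurable maps *)

Section finite_valued.
Context (R : realType) (dT : measure_display) (T : measurableType dT).
Context (P : probability T R) (D : set T) (mD : measurable D).
Context (I : finType) (phi : T -> I).
Hypothesis mphi : forall i, measurable (phi @^-1` [set i]).

Lemma indic_fiber i x : \1_(phi @^-1` [set i]) x = (phi x == i)%:R :> R.
Proof. by rewrite indicE; congr (_%:R); congr nat_of_bool; apply/idP/eqP; rewrite inE. Qed.

Lemma finite_valued_sum (G : I -> T -> R) x :
  G (phi x) x = \sum_i \1_(phi @^-1` [set i]) x * G i x.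
Proof.
rewrite (bigD1 (phi x))//= indic_fiber eqxx mul1r big1 ?addr0// => i iphi.
by rewrite indic_fiber eq_sym (negbTE iphi) mul0r.
Qed.

Lemma measurable_finite_valued (G : I -> T -> R) :
  (forall i, measurable_fun D (G i)) -> measurable_fun D (fun x => G (phi x) x).
Proof.
move=> mG; under eq_fun do rewrite finite_valued_sum.
apply: measurable_sum => i; apply: measurable_funM => //.
Qed.

Lemma integrable_finite_valued (G : I -> R) :
  P.-integrable D (EFin \o (G \o phi)).
Proof.
apply: measurable_bounded_integrable => //.
- by rewrite (le_lt_trans (probability_le1 P mD))// ltry.
- exact: (@measurable_finite_valued (fun i _ => G i)).
- exists (\sum_i `|G i|); split; first exact: num_real.
  move=> M /ltW M1 x _ /=; apply: le_trans M1.
  by rewrite (bigD1 (phi x))//= lerDl sumr_ge0.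
Qed.

Lemma integral_finite_valued (G : I -> R) :
  (\int[P]_(x in D) (G (phi x))%:E =
   (\sum_i fine (P (D `&` phi @^-1` [set i])) * G i)%:E)%E.
Proof.
under eq_integral do rewrite (finite_valued_sum (fun i _ => G i)) -sumEFin.
rewrite integral_sum//=; last first.
  move=> i; apply: (@eq_integrable _ _ _ _ _ mD
    (EFin \o ((fun j => (j == i)%:R * G i) \o phi))); last exact: integrable_finite_valued.
  by move=> x _ /=; rewrite indic_fiber.
rewrite -sumEFin; apply: eq_bigr => i _.
under eq_integral do rewrite mulrC EFinM.
rewrite integralZl//; last first.
  by apply: (integrableS measurableT) => //; exact: integrable_indic.
rewrite integral_indic// setIC muleC EFinM fineK// fin_num_measure//.
exact: measurableI.
Qed.

Lemma Rintegral_finite_valued (G : I -> R) :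
  \int[P]_(x in D) G (phi x) = \sum_i fine (P (D `&` phi @^-1` [set i])) * G i.
Proof. by rewrite /Rintegral integral_finite_valued. Qed.

End finite_valued.

(** The label of a point is its value, seen in the finite set [range s]. Labels in a [finType] turn
    integrals into big sums, and a sample of size [n] into an element of [{ffun 'I_n -> I}]. The
    labelling does not depend on [P] or [D]. *)
Lemma simple_finite_valued (R : realType) (dT : measure_display)
    (T : measurableType dT) (H : hilbert R) (s : T -> H) : simple s ->
  exists (I : finType) (phi : T -> I) (e : I -> H),
    [/\ forall i, measurable (phi @^-1` [set i]), forall x, s x = e (phi x) &
      forall (P : probability T R) (D : set T),
        simple_integral P D s = \sum_i fine (P (D `&` phi @^-1` [set i])) *: e i].
Proof.
move=> [sfin ms]; pose F := fset_set (range s).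
have sF x : s x \in F by rewrite in_fset_set// inE; exists x.
exists F, (fun x => [` sF x]%fset), val.
have fib (i : F) : (fun x => [` sF x]%fset) @^-1` [set i] = s @^-1` [set val i].
  by apply/seteqP; split=> x /= [] => [<-//|sx]; apply: val_inj.
split => [i||P D]; [by rewrite fib; exact: ms|by []|].
rewrite /simple_integral fsbig_finite//= big_seq_fsetE/=.
by apply: eq_bigr => i _; rewrite fib.
Qed.

Section strong_measurability.
Context (R : realType) (dT : measure_display) (T : measurableType dT).
Context (P : probability T R) (D : set T) (mD : measurable D) (H : hilbert R).
Implicit Types (f s : T -> H) (h : H).

(** Distances to fixed vectors replace a sigma-algebra on [H]; they determine norms and inner
    products. The second clause is separability of the image of [D]; the vectors [e j] need not
    belong to that image. *)
Definition strongly_measurable f :=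
  (forall h, measurable_fun D (fun x => hnorm (f x - h))) /\
  exists e : nat -> H, forall x, D x -> forall r : R, 0 < r ->
    exists j, hnorm (f x - e j) < r.

Lemma measurable_hnorm f : strongly_measurable f ->
  measurable_fun D (fun x => hnorm (f x)).
Proof. by move=> [mf _]; under eq_fun do rewrite -[f _]subr0; exact: mf. Qed.

Lemma measurable_dot f h : strongly_measurable f ->
  measurable_fun D (fun x => dot (f x) h).
Proof.
move=> sf.
have E x : dot (f x) h = (hnorm (f x) ^+ 2 + dot h h - hnorm (f x - h) ^+ 2) * 2^-1.
  by rewrite hdist_sqr hnorm_sqr; field.
under eq_fun do rewrite E.
apply: measurable_funM => //; apply: measurable_funB.
  apply: measurable_funD => //; apply: measurable_funX; exact: measurable_hnorm.
by apply: measurable_funX; exact: sf.1.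
Qed.

Lemma measurable_hdist_simple f s : strongly_measurable f -> simple s ->
  measurable_fun D (fun x => hnorm (f x - s x)).
Proof.
move=> sf /simple_finite_valued[I [phi [e [mphi sE _]]]].
under eq_fun do rewrite sE.
apply: (@measurable_finite_valued _ _ _ _ _ _ mphi (fun i x => hnorm (f x - e i))).
by move=> i; exact: sf.1.
Qed.

Lemma integrable_le (f g : T -> R) : measurable_fun D f ->
  (forall x, D x -> `|f x| <= g x) -> P.-integrable D (EFin \o g) ->
  P.-integrable D (EFin \o f).
Proof.
move=> mf fg; apply: le_integrable => //; first exact/measurable_EFinP.
move=> x Dx /=; rewrite lee_fin (le_trans (fg _ Dx))// ler_norm//.
Qed.

Lemma integrable_hdist_simple f s : strongly_measurable f -> simple s ->
  P.-integrable D (EFin \o (fun x => hnorm (f x))) ->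
  P.-integrable D (EFin \o (fun x => hnorm (f x - s x))).
Proof.
move=> sf ss fint; have [I [phi [e [mphi sE _]]]] := simple_finite_valued ss.
apply: (@integrable_le _ (fun x => hnorm (f x) + hnorm (e (phi x)))).
- exact: measurable_hdist_simple.
- by move=> x Dx; rewrite ger0_norm ?hnorm_ge0// sE hnormB.
- have eint := integrable_finite_valued P mD mphi (fun i => hnorm (e i)).
  exact: (integrableD mD fint eint).
Qed.

Lemma integrable_dot f h : strongly_measurable f ->
  P.-integrable D (EFin \o (fun x => hnorm (f x))) ->
  P.-integrable D (EFin \o (fun x => dot (f x) h)).
Proof.
move=> sf fint; apply: (@integrable_le _ (fun x => hnorm h * hnorm (f x))).
- exact: measurable_dot.
- by move=> x Dx; rewrite mulrC normr_dot_le.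
- exact: (integrableZl mD (hnorm h) fint).
Qed.

Lemma dot_simple_integral s h : simple s ->
  P.-integrable D (EFin \o (fun x => dot (s x) h)) /\
  dot (simple_integral P D s) h = \int[P]_(x in D) dot (s x) h.
Proof.
move=> /simple_finite_valued[I [phi [e [mphi sE ->]]]].
have -> : (fun x => dot (s x) h) = (fun i => dot (e i) h) \o phi.
  by apply/funext => x /=; rewrite sE.
split; first exact: integrable_finite_valued.
rewrite (Rintegral_finite_valued P mD mphi) dot_suml.
by apply: eq_bigr => i _; rewrite dotZl.
Qed.

(** Cauchy-Schwarz under the integral. The estimate is used both to show that the integrals of
    approximants are Cauchy and to identify their limit. *)
Lemma dist_dot_simple_integral f s h : strongly_measurable f -> simple s ->
  P.-integrable D (EFin \o (fun x => hnorm (f x))) ->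
  `|dot (simple_integral P D s) h - \int[P]_(x in D) dot (f x) h| <=
    hnorm h * \int[P]_(x in D) hnorm (f x - s x).
Proof.
move=> sf ss fint; have [sint ->] := dot_simple_integral h ss.
have dfint := integrable_dot h sf fint.
have bint := integrableB mD sint dfint.
rewrite -RintegralB// (le_trans (le_normr_Rintegral _ bint))//.
rewrite -RintegralZl//; last exact: integrable_hdist_simple.
apply: le_Rintegral => //.
- exact: (integrable_norm bint).
- exact: (integrableZl mD (hnorm h) (integrable_hdist_simple sf ss fint)).
- by move=> x Dx; rewrite -dotBl (le_trans (normr_dot_le _ _))// mulrC hdistC.
Qed.

(** All inner products of [v] are determined by [f], so the Bochner integral is unique and the
    choice made by [bochner] is harmless. *)
Lemma has_bochner_dot f v h : strongly_measurable f ->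
  P.-integrable D (EFin \o (fun x => hnorm (f x))) ->
  has_bochner_integral P D f v ->
  dot v h = \int[P]_(x in D) dot (f x) h.
Proof.
move=> sf fint [s [ss _ fs sv]].
have E n : (\int[P]_(x in D) (hnorm (f x - s n x))%:E =
            (\int[P]_(x in D) hnorm (f x - s n x))%:E)%E.
  by rewrite /Rintegral fineK// integrable_fin_num//; exact: integrable_hdist_simple.
have fs0 : \int[P]_(x in D) hnorm (f x - s n x) @[n --> \oo] --> (0 : R).
  by move: fs; under eq_fun do rewrite E; move/fine_cvgP => [_].
apply: (@norm_cvg_unique R R^o (dot (simple_integral P D (s n)) h @[n --> \oo])).
  exact: hcvg_dotl.
set I := Rintegral _ _ _.
have b0 : hnorm h * \int[P]_(x in D) hnorm (f x - s n x) @[n --> \oo] --> (0 : R).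
  by rewrite -[X in _ --> X](mulr0 (hnorm h)); apply: cvgM => //; exact: cvg_cst.
apply: (@squeeze_cvgr _ _ _ _
  (fun n => I - hnorm h * \int[P]_(x in D) hnorm (f x - s n x))
  (fun n => I + hnorm h * \int[P]_(x in D) hnorm (f x - s n x))).
- by apply: nearW => n; rewrite -ler_distl dist_dot_simple_integral.
- by rewrite -[X in _ --> X]subr0; apply: cvgB => //; exact: cvg_cst.
- by rewrite -[X in _ --> X]addr0; apply: cvgD => //; exact: cvg_cst.
Qed.

End strong_measurability.

Section bochner_existence.
Context (R : realType) (dT : measure_display) (T : measurableType dT).
Context (P : probability T R) (D : set T) (mD : measurable D) (H : hilbert R).
Context (f : T -> H).
Hypothesis sf : strongly_measurable D f.

Section nearest.
Context (e : nat -> H).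

(** Greedy choice of the closest vector to [f x] among 0 and [e 0], ..., [e (m - 1)]. Starting from
    0 gives the bound by [hnorm (f x)]. Off [D], where measurability of the distances is unknown,
    the value stays 0. *)
Fixpoint nearest (m : nat) (x : T) : H :=
  if m is m'.+1 then
    if `[< D x /\ hnorm (f x - e m') < hnorm (f x - nearest m' x) >]
    then e m' else nearest m' x
  else 0.

Lemma nearest_le m x : hnorm (f x - nearest m x) <= hnorm (f x).
Proof.
elim: m => [|m IHm] /=; first by rewrite subr0.
by case: asboolP => // -[_ /ltW]; move/le_trans; exact.
Qed.

Lemma nearest_le_seq j m x : D x -> (j < m)%N ->
  hnorm (f x - nearest m x) <= hnorm (f x - e j).
Proof.
move=> Dx; elim: m => // m IHm; rewrite ltnS leq_eqVlt => /orP[/eqP ->|jm] /=.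
  by case: asboolP => // /not_andP[//|/negP]; rewrite -leNgt.
by case: asboolP => [[_ /ltW]/le_trans|_]; [apply|]; exact: IHm.
Qed.

Lemma simple_nearest m : simple (nearest m).
Proof.
elim: m => [|m [mfin mm]].
  split; first by apply: (@sub_finite_set _ _ [set 0]) => // _ [x _ <-].
  by move=> v; rewrite [nearest 0]/= preimage_cst; case: ifP.
pose B := [set x | D x /\ hnorm (f x - e m) < hnorm (f x - nearest m x)].
have mB : measurable B.
  have := measurable_fun_ltr (sf.1 (e m)) (measurable_hdist_simple sf (conj mfin mm)).
  move=> /(_ mD [set true]); rewrite (_ : _ `&` _ = B); first exact.
  by apply/seteqP; split=> x [].
split.
  apply: (@sub_finite_set _ _ ([set e m] `|` range (nearest m))); last first.
    by rewrite finite_setU.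
  by move=> _ [x _ <-] /=; case: asboolP => _; [left|right; exists x].
move=> v; rewrite (_ : _ @^-1` _ =
    (B `&` [set x | e m = v]) `|` (~` B `&` nearest m @^-1` [set v])).
  apply: measurableU; apply: measurableI => //.
    by rewrite -[X in measurable X]/((fun=> e m) @^-1` [set v]) preimage_cst; case: ifP.
  exact: measurableC.
apply/seteqP; split=> x /=; first by case: asboolP => Bx; [left|right].
by case=> -[Bx <-]; case: asboolP.
Qed.

Lemma nearest_cvg x : D x ->
  (forall r : R, 0 < r -> exists j, hnorm (f x - e j) < r) ->
  hcvg \oo (nearest^~ x) (f x).
Proof.
move=> Dx ex; apply/cvgrPdist_lt => r /ex[j ej]; exists j.+1 => // m /= jm.
rewrite sub0r normrN ger0_norm ?hnorm_ge0// hdistC.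
exact: le_lt_trans (nearest_le_seq Dx jm) ej.
Qed.

End nearest.

Hypothesis fint : P.-integrable D (EFin \o (fun x => hnorm (f x))).

Lemma bochner_approximation : exists s : nat -> T -> H,
  [/\ forall n, simple (s n), forall x, D x -> hcvg \oo (s^~ x) (f x),
    forall n x, hnorm (f x - s n x) <= hnorm (f x),
    has_bochner_integral P D f (bochner P D f) &
    hcvg \oo (fun n => simple_integral P D (s n)) (bochner P D f)].
Proof.
have [_ [e fe]] := sf; pose s := nearest e; exists s.
have ss n : simple (s n) by exact: simple_nearest.
have sc x : D x -> hcvg \oo (s^~ x) (f x).
  by move=> Dx; apply: nearest_cvg => //; exact: fe.
have sle n x : hnorm (f x - s n x) <= hnorm (f x) by exact: nearest_le.
have ms n : measurable_fun D (fun x => hnorm (f x - s n x)).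
  exact: measurable_hdist_simple.
have ec x : D x -> ((hnorm (f x - s n x))%:E @[n --> \oo] --> 0)%E.
  move=> Dx; apply/fine_cvgP; split; first exact: nearW.
  by rewrite /comp/=; under eq_fun do rewrite hdistC; exact: sc.
have em n : measurable_fun D (fun x => (hnorm (f x - s n x))%:E).
  exact/measurable_EFinP.
have ele n x : D x -> (`|(hnorm (f x - s n x))%:E| <= (hnorm (f x))%:E)%E.
  by rewrite /= lee_fin ger0_norm ?hnorm_ge0.
have [_ _] := dominated_convergence mD em (@measurable_cst _ _ _ _ D 0%E)
  (aeW P ec) fint (aeW P (fun x n => @ele n x)).
rewrite integral0 => fs0.
have E n : (\int[P]_(x in D) (hnorm (f x - s n x))%:E =
            (\int[P]_(x in D) hnorm (f x - s n x))%:E)%E.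
  by rewrite /Rintegral fineK// integrable_fin_num//; exact: integrable_hdist_simple.
have rs0 : \int[P]_(x in D) hnorm (f x - s n x) @[n --> \oo] --> (0 : R).
  by move: fs0; under eq_fun do rewrite E; move/fine_cvgP => [_].
have [v vs] : exists v, hcvg \oo (fun n => simple_integral P D (s n)) v.
  apply: dot_complete => r r0; have r2 : 0 < r / 2 by rewrite divr_gt0.
  move/cvgrPdist_lt : rs0 => /(_ _ r2)[N _ NP]; exists N => m n Nm Nn.
  (* The difference [h] of two simple integrals is tested against itself: both inner products with
     [h] lie within [hnorm h * (r / 2)] of the integral of [dot (f x) h], and [hnorm h] cancels from
     the resulting bound on its square. *)
  rewrite -/(hnorm _); set h := _ - _.
  have [->|h0] := eqVneq h 0; first by rewrite hnorm0.
  have hp : 0 < hnorm h.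
    by rewrite lt_neqAle hnorm_ge0 andbT eq_sym; apply: contra_neq h0; exact: hnorm0_eq0.
  rewrite -(ltr_pM2l hp) -expr2 hnorm_sqr {2}/h dotBr !(dotC h).
  have Im := dist_dot_simple_integral mD h sf (ss m) fint.
  have In := dist_dot_simple_integral mD h sf (ss n) fint.
  have {}Nm := NP m Nm; have {}Nn := NP n Nn.
  rewrite /= !sub0r !normrN in Nm Nn.
  have hm : hnorm h * \int[P]_(x in D) hnorm (f x - s m x) < hnorm h * (r / 2).
    by rewrite ltr_pM2l// (le_lt_trans (ler_norm _)).
  have hn : hnorm h * \int[P]_(x in D) hnorm (f x - s n x) < hnorm h * (r / 2).
    by rewrite ltr_pM2l// (le_lt_trans (ler_norm _)).
  move: (le_lt_trans Im hm) (le_lt_trans In hn); rewrite !ltr_norml.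
  by rewrite [in hnorm h * r](splitr r) mulrDr; lra.
have sv : has_bochner_integral P D f v.
  exists s; split => //; apply: aeW => x Dx; exact: sc.
(* Existence of [v] makes [xget] return some Bochner integral; agreement of all inner products then
   forces it to be [v]. *)
have bv : has_bochner_integral P D f (bochner P D f) by exact: xgetPex (ex_intro _ v sv).
suff -> : bochner P D f = v by [].
apply/eqP; rewrite -subr_eq0; apply/eqP/dot_eq0; rewrite dotBl.
by rewrite (has_bochner_dot mD _ sf fint sv) (has_bochner_dot mD _ sf fint bv) subrr.
Qed.

Lemma dot_bochner h : dot (bochner P D f) h = \int[P]_(x in D) dot (f x) h.
Proof. by have [s [_ _ _ /has_bochner_dot -> ]] := bochner_approximation. Qed.

End bochner_existence.

(** * Empirical means of i.i.d. samples *)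

(** Here [q] is the joint law of the labels of the sample and [p] the law of one label. Only the
    marginals of one and of two coordinates enter, that is, pairwise independence. *)
Lemma finite_iid_bound (R : realType) (H : hilbert R) (n : nat) (I : finType)
    (p : I -> R) (e : I -> H) (q : {ffun 'I_n -> I} -> R) (mu : H) :
  (0 < n)%N -> (forall v, 0 <= q v) -> \sum_v q v = 1 -> \sum_a p a = 1 ->
  (forall i a, \sum_v q v * (v i == a)%:R = p a) ->
  (forall i j a b, i != j ->
    \sum_v q v * ((v i == a) && (v j == b))%:R = p a * p b) ->
  mu = \sum_a p a *: e a ->
  \sum_v q v * `|hnorm (n%:R^-1 *: \sum_i e (v i)) - hnorm mu| <=
    Num.sqrt ((\sum_a p a * hnorm (e a) ^+ 2 - hnorm mu ^+ 2) / n%:R).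
Proof.
move=> n0 q0 q1 p1 marg1 marg2 muE.
have nN0 : n%:R != 0 :> R by rewrite pnatr_eq0 -lt0n.
pose c a := e a - mu; pose Y (v : {ffun 'I_n -> I}) := hnorm (n%:R^-1 *: \sum_i c (v i)).
have E1 i (g : I -> R) : \sum_v q v * g (v i) = \sum_a p a * g a.
  under [RHS]eq_bigr do rewrite -(marg1 i) mulr_suml.
  rewrite exchange_big/=; apply: eq_bigr => v _.
  rewrite (bigD1 (v i))//= eqxx mulr1 big1 ?addr0// => a.
  by rewrite eq_sym => /negbTE ->; rewrite mulr0 mul0r.
have E2 i j (g : I -> I -> R) : i != j ->
    \sum_v q v * g (v i) (v j) = \sum_a \sum_b p a * p b * g a b.
  move=> ij; under [RHS]eq_bigr do under eq_bigr do rewrite -(marg2 i j)// mulr_suml.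
  rewrite pair_bigA/= exchange_big/=; apply: eq_bigr => v _.
  rewrite (bigD1 (v i, v j))//= !eqxx mulr1 big1 ?addr0// => -[a b].
  by rewrite xpair_eqE !(eq_sym _ a, eq_sym _ b) => /negbTE /= ->; rewrite mulr0 mul0r.
have pc : \sum_a p a *: c a = 0.
  rewrite /c; under eq_bigr do rewrite scalerBr.
  by rewrite sumrB -scaler_suml p1 scale1r -muE subrr.
(* Variance as second moment minus squared mean: the part of [c a] along [mu] contributes nothing
   because the centred values [c] have mean 0 by [pc]. *)
have V : \sum_a p a * dot (c a) (c a) = \sum_a p a * hnorm (e a) ^+ 2 - hnorm mu ^+ 2.
  under eq_bigr do rewrite {1}/c dotBl mulrBr -!dotZl.
  rewrite sumrB.
  have -> : \sum_a dot (p a *: e a) (c a) = \sum_a p a * hnorm (e a) ^+ 2 - dot mu mu.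
    under eq_bigr do rewrite dotBr; rewrite sumrB -dot_suml -muE; congr (_ - _).
    by apply: eq_bigr => a _; rewrite dotZl hnorm_sqr.
  have -> : \sum_a dot (p a *: mu) (c a) = 0.
    under eq_bigr do rewrite dotZl -dotZr.
    by rewrite -dot_sumr pc dot0r.
  by rewrite subr0 hnorm_sqr.
have Y2 : \sum_v q v * Y v ^+ 2 =
    (\sum_a p a * hnorm (e a) ^+ 2 - hnorm mu ^+ 2) / n%:R.
  have Y2E v : q v * Y v ^+ 2 =
      n%:R^-1 ^+ 2 * \sum_i \sum_j q v * dot (c (v i)) (c (v j)).
    rewrite /Y hnorm_sqr dotZl dotZr dot_suml.
    under eq_bigr do rewrite dot_sumr.
    under [in RHS]eq_bigr do rewrite -mulr_sumr.
    by rewrite -mulr_sumr; ring.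
  under eq_bigr do rewrite Y2E; rewrite -mulr_sumr exchange_big/=.
  under eq_bigr do rewrite exchange_big/=.
  (* For fixed [i] only [j = i] survives: the other terms factor and vanish by [pc]. The [n] rows
     each give the variance, and the prefactor [n ^ -2] leaves variance over [n]. *)
  rewrite (eq_bigr (fun=> \sum_a p a * dot (c a) (c a))); last first.
    move=> i _; rewrite (bigD1 i)//= (E1 i (fun a => dot (c a) (c a))).
    rewrite [X in _ + X]big1 ?addr0// => j ji.
    rewrite (E2 i j (fun a b => dot (c a) (c b))); last by rewrite eq_sym.
    under eq_bigr do under eq_bigr do rewrite mulrAC -dotZl -mulrC -dotZr.
    under eq_bigr do rewrite -dot_sumr pc dot0r.
    by rewrite big1.
  rewrite sumr_const card_ord V -mulr_natr; set A := _ - _.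
  by field.
set A := \sum_v q v * Y v.
apply: (@le_trans _ _ A).
  apply: ler_sum => v _; rewrite ler_wpM2l//.
  apply: le_trans (ler_dist_hnorm _ _) _; rewrite /Y /c sumrB scalerBr.
  suff -> : n%:R^-1 *: \sum_(i < n) mu = mu by [].
  by rewrite sumr_const card_ord -[mu *+ n]scaler_nat scalerA mulVf// scale1r.
have A0 : 0 <= A by apply: sumr_ge0 => v _; rewrite mulr_ge0 ?hnorm_ge0.
(* Jensen for the square: the mean of [(Y v - A) ^+ 2] is nonnegative and equals the second moment
   of [Y] minus [A ^+ 2]. *)
rewrite -Y2 -[A]ger0_norm// -sqrtr_sqr ler_wsqrtr//.
have : 0 <= \sum_v q v * (Y v - A) ^+ 2.
  by apply: sumr_ge0 => v _; rewrite mulr_ge0 ?sqr_ge0.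
have qYA v : q v * (Y v - A) ^+ 2 = q v * Y v ^+ 2 - (2 * A) * (q v * Y v) + q v * A ^+ 2.
  by ring.
under eq_bigr do rewrite qYA.
by rewrite big_split sumrB -mulr_sumr -mulr_suml q1 /= -/A; lra.
Qed.

Section iid_simple.
Context (R : realType) (d : nat) (X : set (rVborel R d)).
Context (P : probability (rVborel R d) R) (H : hilbert R).
Hypotheses (mX : measurable X) (PX : P X = 1%E).
Context (n : nat) (dO : measure_display) (Omega : measurableType dO).
Context (W : probability Omega R) (Z : 'I_n -> Omega -> rVborel R d).
Hypotheses (n_gt0 : (0 < n)%N) (Ziid : iid_sample X W P Z).
Implicit Types (s f : rVborel R d -> H).

Lemma simple_iid_bound s : simple s ->
  measurable_fun setT (fun w =>
    `|hnorm (n%:R^-1 *: \sum_i s (Z i w)) - hnorm (simple_integral P X s)|) /\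
  (\int[W]_w (`|hnorm (n%:R^-1 *: \sum_i s (Z i w)) -
               hnorm (simple_integral P X s)|)%:E <=
   (Num.sqrt ((\int[P]_(x in X) hnorm (s x) ^+ 2 -
      hnorm (simple_integral P X s) ^+ 2) / n%:R))%:E)%E.
Proof.
move=> /simple_finite_valued[I [phi [e [mphi sE siE]]]].
have [mZ ZX ZP Zind] := Ziid.
pose Psi w : {ffun 'I_n -> I} := [ffun i => phi (Z i w)].
have mfib i a : measurable (Z i @^-1` (phi @^-1` [set a])).
  by rewrite -[X in measurable X]setTI; exact: mZ.
have mPsi v : measurable (Psi @^-1` [set v]).
  rewrite (_ : _ @^-1` _ = \bigcap_(i in [set: 'I_n]) (Z i @^-1` (phi @^-1` [set v i]))).
    by apply: fin_bigcap_measurable => [|i _]; [exact: finite_finset|exact: mfib].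
  apply/seteqP; split=> w /=; first by move=> <- i _ /=; rewrite ffunE.
  by move=> Zv; apply/ffunP => i; rewrite ffunE; exact: Zv.
pose p a := fine (P (X `&` phi @^-1` [set a])).
pose q v := fine (W (setT `&` Psi @^-1` [set v])).
(* [p] is computed on [X], while the preimage is of the full fibre; the two agree because the sample
   takes its values in [X]. *)
have WE i a : W (Z i @^-1` (phi @^-1` [set a])) = (p a)%:E.
  have mXa : measurable (X `&` phi @^-1` [set a]) by exact: measurableI.
  rewrite -[RHS](_ : P (X `&` phi @^-1` [set a]) = _); last first.
    by rewrite fineK// fin_num_measure.
  rewrite -(ZP i)//; congr (W _).
  by apply/seteqP; split => w /= => [Zw|[]//]; split => //; exact: ZX.
set mu := simple_integral P X s; have muE : mu = \sum_a p a *: e a by exact: siE.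
have sum1 (G : {ffun 'I_n -> I} -> R) := integral_finite_valued W measurableT mPsi G.
have q1 : \sum_v q v = 1.
  have := sum1 (fun=> 1); rewrite integral_cst// mul1e => WT.
  have := probability_setT W; rewrite WT => -[<-].
  by apply: eq_bigr => v _; rewrite mulr1.
have p1 : \sum_a p a = 1.
  have := integral_finite_valued P mX mphi (fun=> 1).
  rewrite integral_cst// mul1e => PXE; move: PX; rewrite PXE => -[<-].
  by apply: eq_bigr => v _; rewrite mulr1.
(* An event that depends on the labels alone has as probability the corresponding sum of [q]; both
   marginal conditions are instances. *)
have sumb (A : set Omega) (b : {ffun 'I_n -> I} -> bool) (r : R) : measurable A ->
    (forall w, A w <-> b (Psi w)) -> W A = r%:E -> \sum_v q v * (b v)%:R = r.
  move=> mA Ab WA; have := sum1 (fun v => (b v)%:R).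
  rewrite (_ : (\int[W]_x _)%E = (\int[W]_x (\1_A x)%:E)%E); last first.
    apply: eq_integral => w _; rewrite indicE; congr ((_ %:R)%:E).
    by congr nat_of_bool; apply/idP/idP; rewrite inE => /Ab.
  by rewrite integral_indic// setIT => WAE; move: WA; rewrite WAE => -[].
have marg1 i a : \sum_v q v * (v i == a)%:R = p a.
  apply: (sumb (Z i @^-1` (phi @^-1` [set a])) (fun v => v i == a)) => // w.
  by rewrite ffunE; split => [/= ->|/eqP].
have marg2 i j a b : i != j ->
    \sum_v q v * ((v i == a) && (v j == b))%:R = p a * p b.
  move=> ij; have ji : (j == i) = false by rewrite eq_sym (negbTE ij).
  apply: (sumb (Z i @^-1` (phi @^-1` [set a]) `&` Z j @^-1` (phi @^-1` [set b]))
    (fun v => (v i == a) && (v j == b))).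
  - exact: measurableI.
  - move=> w; rewrite !ffunE; split => [[/= -> ->]|/andP[/eqP ? /eqP ?]//].
    by rewrite !eqxx.
  (* Mutual independence is used for the pair [{i, j}], with the event [a] at [i] and [b] at every
     other index. *)
  - have := Zind [set i; j]%SET (fun l => phi @^-1` [set if l == i then a else b]).
    move=> /(_ (fun l => mphi _)).
    rewrite big_setU1 ?inE//= big_set1 eqxx ji !WE EFinM => <-; congr (W _).
    apply/seteqP; split => w /=.
      move=> [Zi Zj] l /=; rewrite !inE => /orP[]/eqP ->; first by rewrite eqxx.
      by rewrite ji.
    move=> Zw; split; first by have := Zw i; rewrite /= eqxx; apply; rewrite /= !inE eqxx.
    by have := Zw j; rewrite /= ji; apply; rewrite /= !inE eqxx orbT.
pose G (v : {ffun 'I_n -> I}) := `|hnorm (n%:R^-1 *: \sum_i e (v i)) - hnorm mu|.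
have GE w : `|hnorm (n%:R^-1 *: \sum_i s (Z i w)) - hnorm mu| = G (Psi w).
  congr (`|hnorm (_ *: _) - _|); apply: eq_bigr => i _.
  by rewrite sE ffunE.
split.
  under eq_fun do rewrite GE.
  exact: (@measurable_finite_valued _ _ _ _ _ _ mPsi (fun v _ => G v)).
under eq_integral do rewrite GE.
rewrite sum1 lee_fin; under [in leRHS]eq_Rintegral do rewrite sE.
rewrite (Rintegral_finite_valued P mX mphi (fun a => hnorm (e a) ^+ 2)).
apply: (finite_iid_bound n_gt0 _ q1 p1 marg1 marg2 muE) => v.
exact: fine_ge0.
Qed.

End iid_simple.

Lemma integral_le_cvg (R : realType) (dT : measure_display) (T : measurableType dT)
    (mu : {measure set T -> \bar R}) (F : nat -> T -> R) (G : T -> R)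
    (a : nat -> R) (l : R) :
  (forall n, measurable_fun setT (F n)) -> (forall n x, 0 <= F n x) ->
  (forall x, F n x @[n --> \oo] --> G x) ->
  (forall n, (\int[mu]_x (F n x)%:E <= (a n)%:E)%E) -> a n @[n --> \oo] --> l ->
  (\int[mu]_x (G x)%:E <= l%:E)%E.
Proof.
move=> mF F0 FG Fa al.
have eFG x : (F n x)%:E @[n --> \oo] --> (G x)%:E.
  by apply: cvg_EFin; [exact: nearW|exact: FG].
have eal : (a n)%:E @[n --> \oo] --> l%:E by apply: cvg_EFin; [exact: nearW|exact: al].
have := @fatou _ _ _ mu setT measurableT (fun n x => (F n x)%:E)
  (fun n => (measurable_EFinP _ _).2 (mF n)) (fun n x _ => F0 n x).
rewrite (eq_integral (fun x => (G x)%:E)); last first.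
  by move=> x _; have [-> _] := cvg_limn_einf_sup (eFG x).
move/le_trans; apply; rewrite limn_einf_lim -(cvg_lim _ eal)//.
apply: lee_lim; [exact: is_cvg_einfs|by apply/cvg_ex; exists l%:E|].
apply: nearW => n; apply: le_trans (Fa n).
by apply: ereal_inf_lbound; exists n => //=.
Qed.

(** The bound [t <= 1 + t ^+ 2] follows from [(t - 1) ^+ 2 >= 0], and constants are integrable for a
    probability. *)
Lemma integrable_hnorm (R : realType) (dT : measure_display) (T : measurableType dT)
    (P : probability T R) (D : set T) (H : hilbert R) (f : T -> H) :
  measurable D -> strongly_measurable D f ->
  P.-integrable D (EFin \o (fun x => hnorm (f x) ^+ 2)) ->
  P.-integrable D (EFin \o (fun x => hnorm (f x))).
Proof.
move=> mD sf f2; apply: (@integrable_le _ _ _ P D mD _ (fun x => 1 + hnorm (f x) ^+ 2)).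
- exact: measurable_hnorm.
- move=> x Dx; rewrite ger0_norm ?hnorm_ge0//.
  have := sqr_ge0 (hnorm (f x) - 1); rewrite sqrrB1 mulr2n.
  have := hnorm_ge0 (f x); lra.
- exact: (integrableD mD (finite_measure_integrable_cst P 1 mD) f2).
Qed.

Section iid_mean_embedding.
Context (R : realType) (d : nat) (X : set (rVborel R d)).
Context (P : probability (rVborel R d) R) (H : hilbert R).
Hypotheses (mX : measurable X) (PX : P X = 1%E).

Lemma iid_mean_bound (f : rVborel R d -> H) (n : nat) (dO : measure_display)
    (Omega : measurableType dO) (W : probability Omega R)
    (Z : 'I_n -> Omega -> rVborel R d) :
  (0 < n)%N -> iid_sample X W P Z -> strongly_measurable X f ->
  P.-integrable X (EFin \o (fun x => hnorm (f x) ^+ 2)) ->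
  (\int[W]_w (`|hnorm (n%:R^-1 *: \sum_i f (Z i w)) - hnorm (bochner P X f)|)%:E <=
   (Num.sqrt ((\int[P]_(x in X) hnorm (f x) ^+ 2 -
      hnorm (bochner P X f) ^+ 2) / n%:R))%:E)%E.
Proof.
move=> n0 Ziid sf f2; have fint := integrable_hnorm mX sf f2.
have [s [ss sc sle _ sb]] := bochner_approximation mX sf fint.
pose a m := Num.sqrt ((\int[P]_(x in X) hnorm (s m x) ^+ 2 -
      hnorm (simple_integral P X (s m)) ^+ 2) / n%:R).
have sc2 (u : nat -> R) (v : R) : u m @[m --> \oo] --> v -> u m ^+ 2 @[m --> \oo] --> v ^+ 2.
  by move=> uv; under eq_fun do rewrite expr2; rewrite expr2; exact: cvgM.
apply: (@integral_le_cvg _ _ _ W (fun m w =>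
    `|hnorm (n%:R^-1 *: \sum_i s m (Z i w)) - hnorm (simple_integral P X (s m))|) _ a).
- by move=> m; have [] := simple_iid_bound mX PX n0 Ziid (ss m).
- by [].
(* Pointwise convergence on all of [X] transfers to every [w], since [Z i w] is in [X]; no null sets
   have to be pulled back. *)
- move=> w; apply: cvg_norm; apply: cvgB; last exact: hcvg_norm.
  apply: hcvg_norm; apply: hcvgZl.
  have [_ ZX _ _] := Ziid.
  by apply: hcvg_sum => i; apply: sc; exact: ZX.
- by move=> m; have [] := simple_iid_bound mX PX n0 Ziid (ss m).
- rewrite /a; apply: (@continuous_cvg _ _ _ _ _ _ Num.sqrt); first exact: sqrt_continuous.
  apply: cvgM; last exact: cvg_cst.
  apply: cvgB; last by apply: sc2; exact: hcvg_norm.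
  have ms2 m : measurable_fun X (fun x => (hnorm (s m x) ^+ 2)%:E).
    apply/measurable_EFinP; apply: measurable_funX.
    have [I [phi [e [mphi sE _]]]] := simple_finite_valued (ss m).
    under eq_fun do rewrite sE.
    exact: (@measurable_finite_valued _ _ _ _ _ _ mphi (fun i _ => hnorm (e i))).
  have mf2 : measurable_fun X (fun x => (hnorm (f x) ^+ 2)%:E).
    by apply/measurable_EFinP; apply: measurable_funX; exact: measurable_hnorm.
  have cs2 x : X x -> (hnorm (s m x) ^+ 2)%:E @[m --> \oo] --> (hnorm (f x) ^+ 2)%:E.
    by move=> Xx; apply: cvg_EFin; [exact: nearW|apply: sc2; apply: hcvg_norm; exact: sc].
  (* The 4 is the square of the 2 in [hnorm (s m x) <= 2 * hnorm (f x)], the triangle inequality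
     applied to [sle]. *)
  have les2 x m : X x -> (`|(hnorm (s m x) ^+ 2)%:E| <= (4 * hnorm (f x) ^+ 2)%:E)%E.
    move=> Xx; rewrite /= lee_fin ger0_norm ?sqr_ge0//.
    rewrite (_ : 4 * _ = (2 * hnorm (f x)) ^+ 2); last by ring.
    rewrite ler_sqr ?nnegrE ?mulr_ge0 ?hnorm_ge0//.
    have := hdist_triangle (f x) (s m x) 0; rewrite !subr0 hdistC.
    by have := sle m x; lra.
  have [_ _ /=] := dominated_convergence mX ms2 mf2 (aeW P cs2)
    (integrableZl mX 4 f2) (aeW P les2).
  rewrite -[X in _ --> X](fineK (integrable_fin_num mX f2)).
  by move/fine_cvgP => [_].
Qed.

End iid_mean_embedding.

(** * Strong measurability of continuous maps *)

Section euclidean_strong_measurability.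
Context (R : realType) (d : nat) (X : set 'rV[R]_d).
Hypothesis mX : measurable (X : set (rVborel R d)).

Lemma within_continuous_measurable (g : 'rV[R]_d -> R) :
  {within X, continuous g} ->
  measurable_fun (X : set (rVborel R d)) (g : rVborel R d -> R).
Proof.
move=> /continuousP gc; apply: (measurability _ (RGenOpens.measurableE R)).
move=> _ [_ [a [b ->] <-]].
have /open_subspaceP[V oV VX] : open (g @^-1` `]a, b[%classic : set (subspace X)).
  exact/gc/interval_open.
rewrite setIC -VX; apply: measurableI => //.
exact: sub_sigma_algebra.
Qed.

(** Rational points may miss [X], and continuity of the feature map is known only along [X]. So each
    ball with rational centre and radius [1 / (m + 1)] that meets [X] contributes a chosen point of
    [X]; the defaults 0 serve the remaining indices. *)
Lemma rV_dense_sequence : exists q : nat -> 'rV[R]_d,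
  forall x, X x -> forall r : R, 0 < r -> exists2 j, X (q j) & `|x - q j| < r.
Proof.
pose near_center (cm : 'rV[rat]_d * nat) (z : 'rV[R]_d) :=
  X z /\ `|(map_mx ratr cm.1 : 'rV[R]_d) - z| < cm.2.+1%:R^-1.
pose q j : 'rV[R]_d :=
  if (choice.unpickle j : option ('rV[rat]_d * nat)%type) is Some cm
  then xget 0 (near_center cm) else 0.
exists q => x Xx r r0; have r2 : 0 < r / 2 by rewrite divr_gt0.
have [m mr] := filter_ex (near_infty_natSinv_lt (PosNum r2)).
have m0 : 0 < m.+1%:R^-1 :> R by rewrite invr_gt0.
have /choice[c cP] : forall i, exists c : rat, `|x 0 i - ratr c| < (m.+1%:R^-1 : R).
  move=> i; have [c] := @rat_in_itvoo R (x 0 i - m.+1%:R^-1) (x 0 i + m.+1%:R^-1)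
    ltac:(by rewrite ltrD2l gtrN).
  by rewrite in_itv/= => ?; exists c; rewrite distrC ltr_distl.
pose cm : 'rV[rat]_d * nat := (\row_i c i, m).
have cx : near_center cm x.
  split => //; suff : ball (map_mx ratr cm.1 : 'rV[R]_d) (m.+1%:R^-1) x by rewrite -ball_normE.
  by split=> // i j; rewrite !mxE /ball/= distrC (ord1 i); exact: cP.
exists (choice.pickle cm); rewrite /q choice.pickleK;
  case: xgetP => [z -> [Xz zc]|/(_ x)//] //.
rewrite (le_lt_trans (ler_distD (map_mx ratr cm.1 : 'rV[R]_d) _ _))// [r]splitr.
by apply: ltrD; [rewrite distrC; exact: lt_trans cx.2 mr|exact: lt_trans zc mr].
Qed.

Lemma within_continuous_strongly_measurable (H : hilbert R) (f : 'rV[R]_d -> H) :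
  (forall x, X x -> hcvg (within X (nbhs x)) f (f x)) ->
  strongly_measurable (X : set (rVborel R d)) (f : rVborel R d -> H).
Proof.
move=> fc; split=> [h|].
  apply: within_continuous_measurable; apply/subspace_continuousP => x Xx.
  apply: hcvg_norm; apply: hcvgD; [exact: fc|exact: hcvg_cst].
have [q qP] := rV_dense_sequence; exists (f \o q) => x Xx r r0.
have /cvgrPdist_lt/(_ _ r0) := fc x Xx.
rewrite near_withinE => /nbhs_ballP[s /= s0 sP].
have [j Xq xq] := qP x Xx s s0; exists j; rewrite /= hdistC.
have := sP (q j); rewrite sub0r normrN ger0_norm ?hnorm_ge0//; apply => //.
by rewrite -ball_normE.
Qed.

End euclidean_strong_measurability.

(** * Orthonormal bases and the trace *)

(** A maximal orthonormal set is complete, since a nonzero vector orthogonal to it could be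
    normalized and added. This ensures that the [xget] in [trace] picks a true basis. *)
Lemma orthonormal_basis_ex (R : realType) (H : hilbert R) :
  exists B : set H, orthonormal_basis B.
Proof.
pose orth (B : set H) := forall a b, B a -> B b -> dot a b = (a == b)%:R.
have [|B [oB maxB]] := @Zorn_bigcup H orth.
  move=> F Forth Ftot a b [A FA Aa] [A' FA' A'b].
  by have [AA'|A'A] := Ftot _ _ FA FA'; [apply: (Forth A')|apply: (Forth A)] => //; auto.
exists B; split => // f fB; apply: contrapT => /eqP f0.
have nf0 : hnorm f != 0 by apply: contra_neq f0; exact: hnorm0_eq0.
pose g := (hnorm f)^-1 *: f.
have gB b : B b -> dot g b = 0 by move=> Bb; rewrite dotZl fB ?mulr0.
have gg : dot g g = 1 by rewrite dotZl dotZr -hnorm_sqr; field.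
have NBg : ~ B g by move=> /gB; rewrite gg; exact/eqP/oner_neq0.
apply: (maxB (B `|` [set g])).
  split; first exact: subsetUl.
  by move=> /(_ g) gU; apply/NBg/gU; right.
move=> a b [Ba|->] [Bb|->]; last by rewrite gg eqxx.
- exact: oB.
- by rewrite dotC gB//; case: eqP => // ag; rewrite ag in Ba.
- by rewrite gB//; case: eqP => // ag; rewrite -ag in Bb.
Qed.

Section orthonormal_expansion.
Context (R : realType) (H : hilbert R) (B : set H).
Hypothesis onB : orthonormal_basis B.
Implicit Types (f b : H) (r : seq H).

Lemma dot_basis a b : B a -> B b -> dot a b = (a == b)%:R.
Proof. exact: onB.1. Qed.

Definition expansion f r := \sum_(b <- r) dot f b *: b.
Definition coef_sqr f r := \sum_(b <- r) dot f b ^+ 2.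

Local Notation onseq r := (uniq r /\ {subset r <= B}).

Lemma expansion_dot_in f r b : onseq r -> b \in r ->
  dot (expansion f r) b = dot f b.
Proof.
move=> [ur rB] br; rewrite /expansion dot_suml (bigD1_seq b)//= dotZl.
have Bb : B b by apply/set_mem/rB.
rewrite (dot_basis Bb Bb) eqxx mulr1 big_seq_cond big1 ?addr0// => c /andP[cr cb].
have Bc : B c by apply/set_mem/rB.
by rewrite dotZl (dot_basis Bc Bb) (negbTE cb) mulr0.
Qed.

Lemma expansion_dot_out f r b : onseq r -> B b -> b \notin r ->
  dot (expansion f r) b = 0.
Proof.
move=> [ur rB] Bb br; rewrite /expansion dot_suml big_seq big1// => c cr.
have Bc : B c by apply/set_mem/rB.
rewrite dotZl (dot_basis Bc Bb).
by case: eqP cr br => [-> ->//|]; rewrite mulr0.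
Qed.

Lemma dot_expansion f r : dot (expansion f r) f = coef_sqr f r.
Proof.
by rewrite /expansion dot_suml; apply: eq_bigr => b _; rewrite dotZl dotC expr2.
Qed.

Lemma dot_expansion_sub f r r' : onseq r -> onseq r' -> {subset r <= r'} ->
  dot (expansion f r) (expansion f r') = coef_sqr f r.
Proof.
move=> or or' rr'; rewrite {1}/expansion dot_suml /coef_sqr !big_seq.
apply: eq_bigr => b br.
by rewrite dotZl (dotC b) expansion_dot_in ?expr2//; exact: rr'.
Qed.

Lemma hnorm_expansion f r : onseq r -> hnorm (expansion f r) ^+ 2 = coef_sqr f r.
Proof. by move=> or; rewrite hnorm_sqr dot_expansion_sub. Qed.

Lemma bessel f r : onseq r -> coef_sqr f r <= hnorm f ^+ 2.
Proof.
move=> or; have := sqr_ge0 (hnorm (expansion f r - f)).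
by rewrite hdist_sqr -!hnorm_sqr dot_expansion hnorm_expansion//; lra.
Qed.

Lemma esum_coef_ge f r : onseq r ->
  ((coef_sqr f r)%:E <= \esum_(b in B) (dot f b ^+ 2)%:E)%E.
Proof.
move=> [ur rB]; apply: esum_ge; exists [set` r].
  by split; [exact: finite_seq|move=> b /= /rB; rewrite inE].
by rewrite -fsbig_seq// sumEFin.
Qed.

Lemma esum_coef_le f : (\esum_(b in B) (dot f b ^+ 2)%:E <= (hnorm f ^+ 2)%:E)%E.
Proof.
apply: ge_ereal_sup => _ [A [finA AB] <-]; rewrite fsbig_finite//= sumEFin lee_fin.
apply: bessel; split=> [|b]; [exact: fset_uniq|]; rewrite in_fset_set// inE => Ab.
by rewrite inE; exact: AB.
Qed.

(** As [B] may be uncountable, an enumeration is replaced by finite families that carry the sum of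
    squared coefficients up to [1 / (n + 1)]; any enlargement gains less than that. *)
Lemma exhausting_sequence f : exists r : nat -> seq H, forall n, onseq (r n) /\
  forall r', onseq r' -> {subset r n <= r'} ->
    coef_sqr f r' - coef_sqr f (r n) < n.+1%:R^-1.
Proof.
pose s := fine (\esum_(b in B) (dot f b ^+ 2)%:E).
have es : \esum_(b in B) (dot f b ^+ 2)%:E = s%:E.
  rewrite fineK// ge0_fin_numE; last by apply: esum_ge0 => b _; rewrite lee_fin sqr_ge0.
  by rewrite (le_lt_trans (esum_coef_le f))// ltry.
suff /choice[r rP] : forall n : nat, exists r, onseq r /\
    forall r', onseq r' -> {subset r <= r'} ->
      coef_sqr f r' - coef_sqr f r < n.+1%:R^-1 by exists r.
move=> n.
have n0 : 0 < n.+1%:R^-1 :> R by rewrite invr_gt0.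
have [|_ [A [finA AB] <-]] := @ub_ereal_sup_adherent R
    [set \sum_(b \in A) (dot f b ^+ 2)%:E | A in fsets B] _ n0.
  by rewrite -/(esum _ _) es.
rewrite -/(esum _ _) es fsbig_finite//= sumEFin -EFinB lte_fin => sA.
exists (fset_set A); split.
  split=> [|b]; [exact: fset_uniq|].
  by rewrite in_fset_set// inE => Ab; rewrite inE; exact: AB.
move=> r' or' _; have := esum_coef_ge f or'; rewrite es lee_fin.
move=> rs; rewrite ltrBlDr addrC -ltrBlDr; apply: le_lt_trans sA.
by rewrite lerB.
Qed.

Lemma coef_out_lt f (r : seq H) (e : R) b : onseq r -> B b ->
  (forall r', onseq r' -> {subset r <= r'} -> coef_sqr f r' - coef_sqr f r < e) ->
  b \notin r -> dot f b ^+ 2 < e.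
Proof.
move=> [ur rB] Bb re br; have := re (b :: r); rewrite /coef_sqr big_cons addrK.
apply; last by move=> c cr; rewrite inE cr orbT.
by split => [/=|c]; [rewrite br|rewrite inE => /predU1P[->|/rB//]; rewrite inE].
Qed.

Lemma parseval f : (\esum_(b in B) (dot f b ^+ 2)%:E = (hnorm f ^+ 2)%:E)%E.
Proof.
have [r rP] := exhausting_sequence f.
have onr n : onseq (r n) by have [] := rP n.
pose p n := expansion f (r n).
have close m n : hnorm (p m - p n) <= Num.sqrt m.+1%:R^-1 + Num.sqrt n.+1%:R^-1.
  (* [r m] and [r n] need not be nested, so both expansions are compared with the one over their
     union. *)
  pose r' := undup (r m ++ r n).
  have onr' : onseq r'.
    split; [exact: undup_uniq|move=> b]; rewrite mem_undup mem_cat.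
    by case/orP; [exact: (onr m).2|exact: (onr n).2].
  have pr' k : {subset r k <= r'} -> hnorm (expansion f r' - p k) <= Num.sqrt k.+1%:R^-1.
    move=> rk; rewrite -[leLHS]ger0_norm ?hnorm_ge0// -sqrtr_sqr ler_wsqrtr//.
    have := (rP k).2 _ onr' rk; move: (k.+1%:R^-1) => c.
    rewrite hdist_sqr -!hnorm_sqr dotC dot_expansion_sub// !hnorm_expansion//; lra.
  rewrite (le_trans (hdist_triangle (expansion f r') _ _))// lerD//.
    by rewrite hdistC pr'// => b bm; rewrite mem_undup mem_cat bm.
  by rewrite pr'// => b bn; rewrite mem_undup mem_cat bn orbT.
have sqrt0 : Num.sqrt (n.+1%:R^-1 : R) @[n --> \oo] --> (0 : R).
  rewrite -[X in _ --> X]sqrtr0; apply: (@continuous_cvg _ _ _ _ _ _ Num.sqrt).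
    exact: sqrt_continuous.
  exact: cvg_harmonic.
have [l pl] : exists l, hcvg \oo p l.
  apply: dot_complete => e e0; have e2 : 0 < e / 2 by rewrite divr_gt0.
  move/cvgrPdist_lt : sqrt0 => /(_ _ e2)[N _ NP]; exists N => m n Nm Nn.
  rewrite -/(hnorm _) (le_lt_trans (close m n))// [e]splitr.
  by rewrite ltrD//; [have := NP m Nm|have := NP n Nn];
    rewrite /= sub0r normrN ger0_norm ?sqrtr_ge0.
have lf : f - l = 0.
  apply: onB.2 => b Bb; have fp n : `|dot (f - p n) b| <= Num.sqrt n.+1%:R^-1.
    rewrite -sqrtr_sqr ler_wsqrtr// dotBl.
    have [bn|bn] := boolP (b \in r n).
      by rewrite expansion_dot_in// subrr expr0n/= invr_ge0.
    rewrite expansion_dot_out// subr0 ltW//.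
    exact: coef_out_lt (onr n) Bb (rP n).2 bn.
  apply: (@norm_cvg_unique R R^o (dot (f - p n) b @[n --> \oo])).
    by apply: hcvg_dotl; apply: hcvgB pl; exact: hcvg_cst.
  apply: (@squeeze_cvgr _ _ _ _ (fun n => - Num.sqrt n.+1%:R^-1)
    (fun n => Num.sqrt n.+1%:R^-1)) => //.
    by apply: nearW => n; rewrite -ler_norml.
  by rewrite -[X in _ --> X]oppr0; exact: cvgN.
have {}lf : f = l by apply/eqP; rewrite -subr_eq0 lf.
(* One side is Bessel. For the other, [hnorm f ^+ 2] is the limit of the squared norms of the finite
   expansions, each at most the full sum. *)
apply/eqP; rewrite eq_le esum_coef_le/=.
have -> : (hnorm f ^+ 2)%:E = limn (fun n => (hnorm (p n) ^+ 2)%:E).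
  apply/esym/cvg_lim => //; apply: cvg_EFin; first exact: nearW.
  rewrite /comp/= expr2; under eq_fun do rewrite expr2.
  by rewrite lf; apply: cvgM; exact: hcvg_norm.
apply: lime_le.
  apply/cvg_ex; exists (hnorm f ^+ 2)%:E; apply: cvg_EFin; first exact: nearW.
  rewrite /comp/= expr2; under eq_fun do rewrite expr2.
  by rewrite lf; apply: cvgM; exact: hcvg_norm.
by apply: nearW => n; rewrite hnorm_expansion// esum_coef_ge.
Qed.

(** A basis vector outside every [r n] has squared coefficient below every [1 / (n + 1)], hence
    zero. *)
Lemma countable_coef f : countable [set b | B b /\ dot f b != 0].
Proof.
have [r rP] := exhausting_sequence f.
apply: (@sub_countable _ _ _ (\bigcup_n [set` r n])); last first.
  by apply: bigcup_countable => // n _; by apply: finite_set_countable; exact: finite_seq.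
apply: subset_card_le => b [Bb fb]; apply: contrapT => nb.
have fb2 : 0 < dot f b ^+ 2 by rewrite exprn_even_gt0.
have [n] := filter_ex (near_infty_natSinv_lt (PosNum fb2)); apply/negP; rewrite -leNgt ltW//.
apply: (coef_out_lt (rP n).1 Bb (rP n).2).
by apply/negP => bn; apply: nb; exists n.
Qed.

End orthonormal_expansion.

(** The predicate [N] marks the codes of elements of [A]; other indices contribute 0, so finite and
    infinite sets are treated alike. The enumeration is fixed before [c], so the same one serves the
    integrated and the pointwise sums. *)
Lemma countable_esum_series (R : realType) (T : choiceType) (t0 : T) (A : set T) :
  countable A -> exists (N : pred nat) (e : nat -> T), (forall n, N n -> A (e n)) /\
    forall c : T -> \bar R, (forall t, A t -> 0 <= c t)%E ->
      (\esum_(t in A) c t = \sum_(n <oo) if N n then c (e n) else 0)%E.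
Proof.
move=> /countable_injP[g gi].
pose e n := xget t0 [set t | A t /\ g t = n].
have eg t : A t -> e (g t) = t.
  move=> At; rewrite /e; case: xgetP => [u _ [Au ug]|/(_ t) h].
    by apply: gi => //; rewrite inE.
  by exfalso; apply: h.
pose N : pred nat := fun n => `[< (g @` A) n >].
have Ne n : N n -> A (e n) by move=> /asboolP[t At <-]; rewrite eg.
exists N, e; split => // c c0.
rewrite -eseries_mkcond nneseries_esum; last by move=> n /Ne; exact: c0.
have bij : set_bij A [set n | N n] g.
  split => // [t At|n /asboolP//]; first by apply/asboolP; exists t.
rewrite (reindex_esum _ _ _ _ bij)//; apply: eq_esum => t At.
by rewrite eg.
Qed.

Section trace_covariance.
Context (R : realType) (dT : measure_display) (T : measurableType dT).
Context (P : probability T R) (D : set T) (mD : measurable D) (H : hilbert R).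
Context (f : T -> H).
Hypothesis sf : strongly_measurable D f.
Hypothesis f2 : P.-integrable D (EFin \o (fun x => hnorm (f x) ^+ 2)).

Lemma tensor_strongly_measurable v :
  strongly_measurable D (fun x => tensor (f x) (f x) v).
Proof.
split=> [h|].
  have E x : hnorm (tensor (f x) (f x) v - h) = Num.sqrt
      (dot (f x) v ^+ 2 * hnorm (f x) ^+ 2 - 2 * (dot (f x) v * dot (f x) h) + dot h h).
    rewrite -[LHS]ger0_norm ?hnorm_ge0// -sqrtr_sqr hdist_sqr /tensor !dotZl dotZr.
    by congr Num.sqrt; rewrite hnorm_sqr; ring.
  under eq_fun do rewrite E.
  apply: measurableT_comp; first exact: continuous_measurable_fun (@sqrt_continuous R).
  apply: measurable_funD => //; apply: measurable_funB.
    by apply: measurable_funM; apply: measurable_funX;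
      [exact: measurable_dot|exact: measurable_hnorm].
  by apply: measurable_funM => //; apply: measurable_funM; exact: measurable_dot.
(* The map [a |-> dot a v *: a] is continuous, so it carries a family approximating [f] to one
   approximating the tensor. *)
have [_ [e fe]] := sf; exists (fun j => dot (e j) v *: e j) => x Dx r r0.
have /choice[j jP] : forall n : nat, exists j, hnorm (f x - e j) < n.+1%:R^-1.
  by move=> n; apply: fe => //; rewrite invr_gt0.
have ej : hcvg \oo (e \o j) (f x).
  apply: (@hcvg_le _ _ _ _ _ _ _ (@harmonic R)); last exact: cvg_harmonic.
  by apply: nearW => n; rewrite hdistC; apply/ltW/jP.
have : hcvg \oo (fun n => dot (e (j n)) v *: e (j n)) (dot (f x) v *: f x).
  by apply: (hcvgZ _ ej); exact: hcvg_dotl ej.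
move=> /cvgrPdist_lt/(_ _ r0)/filter_ex[n].
rewrite sub0r normrN ger0_norm ?hnorm_ge0// hdistC => ?.
by exists (j n).
Qed.

Lemma tensor_integrable v :
  P.-integrable D (EFin \o (fun x => hnorm (tensor (f x) (f x) v))).
Proof.
apply: (@integrable_le _ _ _ P D mD _ (fun x => hnorm v * hnorm (f x) ^+ 2)).
- exact: measurable_hnorm (tensor_strongly_measurable v).
- move=> x Dx; rewrite ger0_norm ?hnorm_ge0// hnormZ expr2 mulrA.
  by rewrite ler_wpM2r ?hnorm_ge0// mulrC normr_dot_le.
- exact: (integrableZl mD (hnorm v) f2).
Qed.

Definition covariance_op v := bochner P D (fun x => tensor (f x) (f x) v).

Lemma dot_covariance_op v :
  ((dot (covariance_op v) v)%:E = \int[P]_(x in D) (dot (f x) v ^+ 2)%:E)%E.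
Proof.
have st := tensor_strongly_measurable v; have it := tensor_integrable v.
rewrite /covariance_op (dot_bochner mD st it) /Rintegral fineK; last first.
  by apply: integrable_fin_num => //; exact: integrable_dot st it.
by apply: eq_integral => x _; rewrite /tensor dotZl -expr2.
Qed.

Lemma trace_covariance_op :
  trace covariance_op = \int[P]_(x in D) hnorm (f x) ^+ 2.
Proof.
have onB : orthonormal_basis (xget set0 (@orthonormal_basis R H)).
  exact: xgetPex (orthonormal_basis_ex H).
rewrite /trace /Rintegral; congr fine; move: (xget _ _) onB => B onB.
have [_ [e fe]] := sf.
pose B0 := \bigcup_j [set b | B b /\ dot (e j) b != 0].
have cB0 : countable B0 by apply: bigcup_countable => // j _; exact: countable_coef.
(* A basis vector orthogonal to every [e j] is orthogonal to [f x]: its inner product with [f x]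
   equals that with [f x - e j], which can be made arbitrarily small. *)
have B0P x b : D x -> B b -> ~ B0 b -> dot (f x) b = 0.
  move=> Dx Bb nb; have eb j : dot (e j) b = 0.
    by apply/eqP/negP => /negP ejb; apply: nb; exists j.
  have b1 : hnorm b = 1 by rewrite /hnorm onB.1// eqxx sqrtr1.
  apply/eqP; rewrite -normr_le0; apply/ler_addgt0Pl => r r0.
  have [j] := fe x Dx r r0; rewrite addr0 => /ltW; apply: le_trans.
  by rewrite -[dot _ b]subr0 -(eb j) -dotBl -[leRHS]mulr1 -b1 normr_dot_le.
have esumB0 (c : H -> \bar R) : (forall b, B b -> ~ B0 b -> c b = 0%E) ->
    (\esum_(b in B) c b = \esum_(b in B0) c b)%E.
  move=> c0; have -> : B0 = B `&` B0.
    by rewrite setIidr// => b [j _ []].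
  rewrite esum_mkcondr; apply: eq_esum => b Bb.
  by case: ifPn => // /negP; rewrite inE => /c0 ->.
have [N [a [Na aE]]] := countable_esum_series R 0 cB0.
rewrite (eq_esum (fun b _ => dot_covariance_op b)) esumB0; last first.
  move=> b Bb nb; rewrite integral0_eq// => x Dx.
  by rewrite (B0P x b)// expr0n.
rewrite aE; last by move=> b _; apply: integral_ge0 => x _; rewrite lee_fin sqr_ge0.
transitivity (\sum_(n <oo) \int[P]_(x in D)
    (if N n then (dot (f x) (a n) ^+ 2)%:E else 0))%E.
  by apply: eq_eseriesr => n _; case: ifP => // _; rewrite integral0.
rewrite -integral_nneseries//; last 2 first.
- move=> n; case: (N n); last exact: measurable_cst.
  by apply/measurable_EFinP; apply: measurable_funX; exact: measurable_dot.
- by move=> n x _; case: ifP => // _; rewrite lee_fin sqr_ge0.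
apply: eq_integral => x; rewrite inE => Dx.
rewrite -(aE (fun b => (dot (f x) b ^+ 2)%:E)); last by move=> b _; rewrite lee_fin sqr_ge0.
rewrite -esumB0; first exact: parseval.
by move=> b Bb nb; rewrite (B0P x b)// expr0n.
Qed.

End trace_covariance.

Theorem theorem1 (R : realType) (d : nat)
  (X U : set 'rV[R]_d) (mX : measurable (X : set (rVborel R d)))
  (oU : open U) (XU : X `<=` U) (Xreg : X `<=` closure (interior X))
  (lam : {measure set (rVborel R d) -> \bar R}) (hlam : is_lebesgue lam)
  (P0 : probability (rVborel R d) R) (P0X : P0 X = 1%E)
  (p0 : 'rV[R]_d -> R)
  (p0_density : forall A : set (rVborel R d), measurable A -> A `<=` X ->
     P0 A = (\int[lam]_(x in A) (p0 x)%:E)%E)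
  (p0_C1 : C1_on U p0) (p0_gt0 : forall x, X x -> 0 < p0 x)
  (k : 'rV[R]_d -> 'rV[R]_d -> R)
  (k_C11 : C11_on U k) (k_pd : posdef_kernel X k)
  (Hk : rkhs X k)
  (P0_mom : (mean_stein_diag Hk p0 P0 < +oo)%E)
  (stein_identity : stein_mean Hk p0 P0 = 0) :
  (forall (P : probability (rVborel R d) R), P X = 1%E ->
     (mean_stein_diag Hk p0 P < +oo)%E ->
   forall (n : nat), (1 <= n)%N ->
   forall (dO : measure_display) (Omega : measurableType dO)
     (W : probability Omega R) (Z : 'I_n -> Omega -> rVborel R d),
     iid_sample X W P Z ->
     ('E_W[fun w => `|KSD_V Hk p0 (fun i => Z i w) - KSD Hk p0 P|%R] <=
        (Num.sqrt ((fine (mean_stein_diag Hk p0 P) - KSD Hk p0 P ^+ 2)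
                     / n%:R))%:E <=
        (Num.sqrt (fine (mean_stein_diag Hk p0 P) / n%:R))%:E)%E) /\
  (forall (n : nat), (1 <= n)%N ->
   forall (dO : measure_display) (Omega : measurableType dO)
     (W : probability Omega R) (Z : 'I_n -> Omega -> rVborel R d),
     iid_sample X W P0 Z ->
     ('E_W[fun w => KSD_V Hk p0 (fun i => Z i w)] <=
        (Num.sqrt (trace (stein_covariance Hk p0 P0) / n%:R))%:E)%E).
Proof.
(* The diagonal of the Stein kernel is the squared norm of the feature, so the moment condition is
   exactly square integrability. *)
have stein_feature_spec (P : probability (rVborel R d) R) :
    (mean_stein_diag Hk p0 P < +oo)%E ->
    [/\ strongly_measurable (X : set (rVborel R d)) (stein_feature Hk p0),
      P.-integrable (X : set (rVborel R d))
        (EFin \o (fun x => hnorm (stein_feature Hk p0 x) ^+ 2)) &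
      fine (mean_stein_diag Hk p0 P) =
        \int[P]_(x in (X : set (rVborel R d))) hnorm (stein_feature Hk p0 x) ^+ 2].
  move=> P_mom.
  have sxi : strongly_measurable (X : set (rVborel R d)) (stein_feature Hk p0).
    apply: within_continuous_strongly_measurable => // x Xx.
    exact: (stein_feature_continuous Hk oU XU Xreg k_C11 p0_C1 p0_gt0).
  have momE : mean_stein_diag Hk p0 P = (\int[P]_(x in (X : set (rVborel R d)))
      (hnorm (stein_feature Hk p0 x) ^+ 2)%:E)%E.
    by apply: eq_integral => x _; rewrite hnorm_sqr.
  split => //; last by rewrite momE.
  apply/integrableP; split.
    by apply/measurable_EFinP; apply: measurable_funX; exact: measurable_hnorm.
  under eq_integral do rewrite /= ger0_norm ?sqr_ge0//.
  by rewrite -momE.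
have bound (P : probability (rVborel R d) R) : P X = 1%E ->
    (mean_stein_diag Hk p0 P < +oo)%E ->
    forall (n : nat), (1 <= n)%N ->
    forall (dO : measure_display) (Omega : measurableType dO)
      (W : probability Omega R) (Z : 'I_n -> Omega -> rVborel R d),
    iid_sample X W P Z ->
    ('E_W[fun w => `|KSD_V Hk p0 (fun i => Z i w) - KSD Hk p0 P|%R] <=
      (Num.sqrt ((fine (mean_stein_diag Hk p0 P) - KSD Hk p0 P ^+ 2) / n%:R))%:E)%E.
  move=> PX P_mom n n1 dO Omega W Z Ziid.
  have [sxi xi2 ->] := stein_feature_spec P P_mom.
  rewrite unlock.
  exact: (iid_mean_bound mX PX n1 Ziid sxi xi2).
split.
  move=> P PX P_mom n n1 dO Omega W Z Ziid; rewrite bound//= lee_fin.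
  by rewrite ler_wsqrtr// ler_wpM2r// gerBl sqr_ge0.
move=> n n1 dO Omega W Z Ziid; have [sxi xi2 momE] := stein_feature_spec P0 P0_mom.
(* [stein_covariance] unfolds to [covariance_op] of the feature map, so the trace formula applies by
   conversion. *)
have -> : trace (stein_covariance Hk p0 P0) = fine (mean_stein_diag Hk p0 P0).
  by rewrite momE -(trace_covariance_op mX sxi xi2).
have KSD0 : KSD Hk p0 P0 = 0 by rewrite /KSD stein_identity hnorm0.
have := bound P0 P0X P0_mom n n1 dO Omega W Z Ziid.
(* With [KSD] zero at the target, the absolute error is [KSD_V] itself, a norm. *)
rewrite KSD0 expr0n subr0; apply: le_trans.
rewrite unlock.
by under [leRHS]eq_integral do rewrite subr0 ger0_norm ?hnorm_ge0//.
Qed.
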